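(* For $n\ge3$, the surjective Lie algebra homomorphism $$\overline{\Theta|_{\mathfrak b_n}}:H_1(\mathfrak b_n,\mathbf Z)\to \mathfrak b_n(1)\oplus\bigoplus_{m\ge1}\mathrm{Im}(\mathrm{MT}_{2m+1}^B)$$ induced by the identity map on $\mathfrak b_n(1)$ and by the Morita traces $\mathrm{MT}_{2m+1}^B$ on $\mathfrak b_n(2m+1)$ for $m\ge1$ (and zero on the parts of even degree) is not injective.
   Context: Let $\mathcal L_n=\bigoplus_{k\ge1}\mathcal L_n(k)$ be the free Lie algebra over $\mathbf Z$ on the free abelian group $H$ with basis $x_1,\dots,x_n$, graded by weight, and let $x_1^*,\dots,x_n^*$ be the dual basis of $H^*$. Brackets $[a_1,\dots,a_k]$ are left-normed. An element of $H^*\otimes_{\mathbf Z}\mathcal L_n(k+1)=\mathrm{Hom}_{\mathbf Z}(H,\mathcal L_n(k+1))$ is identified with the derivation of $\mathcal L_n$ of degree $k$ extending it; the bracket of derivations is $[f,g]=g\circ f-f\circ g$. For $k\ge1$, $\mathfrak p_n(k)$ is the $\mathbf Z$-submodule of $H^*\otimes\mathcal L_n(k+1)$ generated by all $x_i^*\otimes[x_{j_1},\dots,x_{j_k},x_i]$ with $1\le i,j_1,\dots,j_k\le n$, and $\mathfrak b_n(k)=\{\sum_i x_i^*\otimes C_i\in\mathfrak p_n(k)\mid\sum_iC_i=0\}$. The graded sum $\mathfrak b_n=\bigoplus_{k\ge1}\mathfrak b_n(k)$ is a Lie subalgebra of the derivation Lie algebra (the special derivation Lie algebra). $H_1(\mathfrak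 b_n,\mathbf Z)=\mathfrak b_n/[\mathfrak b_n,\mathfrak b_n]$ is its abelianization. Embed $\mathcal L_n(k+1)\subset H^{\otimes(k+1)}$ via $[a,b]=a\otimes b-b\otimes a$. The Morita trace $\mathrm{MT}_k:H^*\otimes\mathcal L_n(k+1)\to S^kH$ is the composite of this embedding, the contraction $x_i^*\otimes x_{j_1}\otimes\cdots\otimes x_{j_{k+1}}\mapsto x_i^*(x_{j_1})\,x_{j_2}\otimes\cdots\otimes x_{j_{k+1}}$, and the projection $H^{\otimes k}\to S^kH$; $\mathrm{MT}_k^B$ is its restriction to $\mathfrak b_n(k)$. For $k\ge2$ the map $\mathrm{MT}_k$ vanishes on brackets of positive-degree derivations (Morita), so the map above is well defined; its target is regarded as an abelian Lie algebra. *)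

(* Defs.v *)
From HB Require Import structures.
From mathcomp Require Import all_boot all_order all_algebra ssrAC.
From mathcomp Require Import finmap boolp.
From mathcomp.multinomials Require Import monalg.

Set Implicit Arguments.
Unset Strict Implicit.
Unset Printing Implicit Defensive.

Import GRing.Theory.

Local Open Scope ring_scope.
Local Open Scope quotient_scope.

Reserved Notation "[ 'lie' a , b ]" (at level 0, format "[ 'lie'  a ,  b ]").

(* Lie algebras over Z: biadditive is the same as Z-bilinear. *)
HB.mixin Record Zmodule_isLie L of GRing.Zmodule L := {
  lie_br : L -> L -> L;
  lieDl : forall a b c, lie_br (a + b) c = lie_br a c + lie_br b c;
  lieDr : forall a b c, lie_br a (b + c) = lie_br a b + lie_br a c;
  liexx : forall a, lie_br a a = 0;
  lie_jacobi : forall a b c,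
    lie_br a (lie_br b c) + lie_br b (lie_br c a) + lie_br c (lie_br a b) = 0
}.

#[short(type="lieType")]
HB.structure Definition Lie := {L of GRing.Zmodule L & Zmodule_isLie L}.

Notation "[ 'lie' a , b ]" := (lie_br a b) : ring_scope.

Section LieTheory.
Variable L : lieType.
Implicit Types a b c : L.

Lemma lie0r a : [lie a, 0] = 0.
Proof. by apply: (addrI [lie a, 0]); rewrite -lieDr !addr0. Qed.

Lemma lie0l a : [lie 0, a] = 0.
Proof. by apply: (addrI [lie 0, a]); rewrite -lieDl !addr0. Qed.

Lemma lieNr a b : [lie a, - b] = - [lie a, b].
Proof. by apply/eqP; rewrite -addr_eq0 -lieDr addNr lie0r. Qed.

Lemma lieNl a b : [lie - a, b] = - [lie a, b].
Proof. by apply/eqP; rewrite -addr_eq0 -lieDl addNr lie0l. Qed.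

Lemma lieBr a b c : [lie a, b - c] = [lie a, b] - [lie a, c].
Proof. by rewrite lieDr lieNr. Qed.

Lemma lieBl a b c : [lie a - b, c] = [lie a, c] - [lie b, c].
Proof. by rewrite lieDl lieNl. Qed.

Lemma lieC a b : [lie a, b] = - [lie b, a].
Proof.
apply/eqP; rewrite -addr_eq0; apply/eqP.
by have := liexx (a + b); rewrite lieDl !lieDr !liexx add0r addr0.
Qed.

Lemma lieA a b c : [lie a, [lie b, c]] = [lie [lie a, b], c] - [lie [lie a, c], b].
Proof.
have := lie_jacobi a b c => /eqP; rewrite -addrA addr_eq0 => /eqP ->.
by rewrite opprD addrC (lieC c [lie a, b]) (lieC c a) lieNr opprK (lieC b) !opprK.
Qed.

Lemma lie_suml (I : Type) (r : seq I) (P : pred I) (F : I -> L) b :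
  [lie \sum_(i <- r | P i) F i, b] = \sum_(i <- r | P i) [lie F i, b].
Proof. by apply: (big_morph (fun a => [lie a, b])) => [x y|]; rewrite ?lieDl ?lie0l. Qed.

Lemma lie_sumr (I : Type) (r : seq I) (P : pred I) (F : I -> L) b :
  [lie b, \sum_(i <- r | P i) F i] = \sum_(i <- r | P i) [lie b, F i].
Proof. by apply: (big_morph (fun a => [lie b, a])) => [x y|]; rewrite ?lieDr ?lie0r. Qed.

(* Left-normed brackets [a_1, ..., a_k] = [[...[a_1, a_2], ...], a_k]. *)
Definition lnorm (s : seq L) : L :=
  if s is a :: s' then foldl (@lie_br L) a s' else 0.

Lemma lnorm_rcons s a : s != [::] -> lnorm (rcons s a) = [lie lnorm s, a].
Proof. by case: s => //= b s _; rewrite -cats1 foldl_cat. Qed.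

End LieTheory.

Definition lie_morphism (L M : lieType) (f : L -> M) : Prop :=
  {morph f : a b / [lie a, b] >-> [lie a, b]}.

Inductive zspan (V : zmodType) (S : V -> Prop) : V -> Prop :=
| zspan_gen x : S x -> zspan S x
| zspan0 : zspan S 0
| zspanB x y : zspan S x -> zspan S y -> zspan S (x - y).

Section ZSpan.
Variables (V : zmodType) (S : V -> Prop).

Lemma zspanN x : zspan S x -> zspan S (- x).
Proof. by rewrite -[- x]add0r; apply: zspanB; apply: zspan0. Qed.

Lemma zspanD x y : zspan S x -> zspan S y -> zspan S (x + y).
Proof. by move=> Sx Sy; rewrite -[y]opprK; apply: zspanB => //; apply: zspanN. Qed.

Lemma zspan_sum (I : Type) (r : seq I) (F : I -> V) :
  (forall i, zspan S (F i)) -> zspan S (\sum_(i <- r) F i).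
Proof.
by move=> SF; apply: (big_ind (zspan S)) => //; [apply: zspan0 | apply: zspanD].
Qed.

End ZSpan.

Section SubZmodule.
Variables (V : zmodType) (S : zmodClosed V).
Definition zsub := {x : V | x \in S}.
HB.instance Definition _ := SubChoice.on zsub.
HB.instance Definition _ := [SubChoice_isSubZmodule of zsub by <:].
End SubZmodule.

Inductive lterm (n : nat) : Type :=
| LGen of 'I_n
| LZero
| LOpp of lterm n
| LAdd of lterm n & lterm n
| LBr of lterm n & lterm n.

HB.instance Definition _ n := gen_eqMixin (lterm n).
HB.instance Definition _ n := gen_choiceMixin (lterm n).

(* The smallest congruence making terms modulo it a Lie algebra over Z. *)
Inductive lcong n : lterm n -> lterm n -> Prop :=
| lcong_refl s : lcong s s
| lcong_sym s t : lcong s t -> lcong t s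
| lcong_trans s t u : lcong s t -> lcong t u -> lcong s u
| lcong_opp s s' : lcong s s' -> lcong (LOpp s) (LOpp s')
| lcong_add s s' t t' :
    lcong s s' -> lcong t t' -> lcong (LAdd s t) (LAdd s' t')
| lcong_br s s' t t' :
    lcong s s' -> lcong t t' -> lcong (LBr s t) (LBr s' t')
| lcong_addA s t u : lcong (LAdd s (LAdd t u)) (LAdd (LAdd s t) u)
| lcong_addC s t : lcong (LAdd s t) (LAdd t s)
| lcong_add0 s : lcong (LAdd (LZero n) s) s
| lcong_addN s : lcong (LAdd (LOpp s) s) (LZero n)
| lcong_brDl s t u : lcong (LBr (LAdd s t) u) (LAdd (LBr s u) (LBr t u))
| lcong_brDr s t u : lcong (LBr s (LAdd t u)) (LAdd (LBr s t) (LBr s u))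
| lcong_brxx s : lcong (LBr s s) (LZero n)
| lcong_jacobi s t u :
    lcong (LAdd (LAdd (LBr s (LBr t u)) (LBr t (LBr u s))) (LBr u (LBr s t)))
          (LZero n).

Section FreeLie.
Variable n : nat.
Implicit Types s t u : lterm n.

Definition lcongb s t : bool := `[< lcong s t >].

Lemma lcongb_refl : reflexive lcongb.
Proof. by move=> s; apply/asboolP; apply: lcong_refl. Qed.
Lemma lcongb_sym : symmetric lcongb.
Proof. by move=> s t; apply/asboolP/asboolP; apply: lcong_sym. Qed.
Lemma lcongb_trans : transitive lcongb.
Proof. by move=> t s u /asboolP st /asboolP tu; apply/asboolP; apply: lcong_trans tu. Qed.

Canonical lcong_equiv := EquivRel lcongb lcongb_refl lcongb_sym lcongb_trans.

Definition freeLie := {eq_quot lcongb}.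
HB.instance Definition _ := Choice.on freeLie.
HB.instance Definition _ := EqQuotient.on freeLie.

Local Notation cls := (\pi_freeLie).

Lemma cls_eq s t : cls s = cls t <-> lcong s t.
Proof.
split; first by move/eqmodP/asboolP.
by move=> st; apply/eqmodP/asboolP.
Qed.

Lemma cls_repr s : lcong (repr (cls s)) s.
Proof. by apply/cls_eq; rewrite reprK. Qed.

Definition fl_zero : freeLie := cls (LZero n).
Definition fl_opp (x : freeLie) : freeLie := cls (LOpp (repr x)).
Definition fl_add (x y : freeLie) : freeLie := cls (LAdd (repr x) (repr y)).
Definition fl_br (x y : freeLie) : freeLie := cls (LBr (repr x) (repr y)).
Definition fl_gen (i : 'I_n) : freeLie := cls (LGen i).

Lemma fl_oppE s : fl_opp (cls s) = cls (LOpp s).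
Proof. by apply/cls_eq; apply: lcong_opp; apply: cls_repr. Qed.
Lemma fl_addE s t : fl_add (cls s) (cls t) = cls (LAdd s t).
Proof. by apply/cls_eq; apply: lcong_add; apply: cls_repr. Qed.
Lemma fl_brE s t : fl_br (cls s) (cls t) = cls (LBr s t).
Proof. by apply/cls_eq; apply: lcong_br; apply: cls_repr. Qed.

Let clsW (P : freeLie -> Prop) : (forall s, P (cls s)) -> forall x, P x.
Proof. by move=> Ps x; rewrite -[x]reprK. Qed.

Lemma fl_addA : associative fl_add.
Proof.
by elim/clsW=> s; elim/clsW=> t; elim/clsW=> u; rewrite !fl_addE;
  apply/cls_eq; apply: lcong_addA.
Qed.
Lemma fl_addC : commutative fl_add.
Proof.
by elim/clsW=> s; elim/clsW=> t; rewrite !fl_addE; apply/cls_eq; apply: lcong_addC.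
Qed.
Lemma fl_add0 : left_id fl_zero fl_add.
Proof. by elim/clsW=> s; rewrite fl_addE; apply/cls_eq; apply: lcong_add0. Qed.
Lemma fl_addN : left_inverse fl_zero fl_opp fl_add.
Proof.
by elim/clsW=> s; rewrite fl_oppE fl_addE; apply/cls_eq; apply: lcong_addN.
Qed.

HB.instance Definition _ :=
  GRing.isZmodule.Build freeLie fl_addA fl_addC fl_add0 fl_addN.

Lemma fl_brDl (x y z : freeLie) : fl_br (x + y) z = fl_br x z + fl_br y z.
Proof.
elim/clsW: x => s; elim/clsW: y => t; elim/clsW: z => u.
rewrite [_ + _]fl_addE !fl_brE [RHS]fl_addE.
by apply/cls_eq; apply: lcong_brDl.
Qed.
Lemma fl_brDr (x y z : freeLie) : fl_br x (y + z) = fl_br x y + fl_br x z.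
Proof.
elim/clsW: x => s; elim/clsW: y => t; elim/clsW: z => u.
rewrite [_ + _]fl_addE !fl_brE [RHS]fl_addE.
by apply/cls_eq; apply: lcong_brDr.
Qed.
Lemma fl_brxx (x : freeLie) : fl_br x x = 0.
Proof. by elim/clsW: x => s; rewrite fl_brE; apply/cls_eq; apply: lcong_brxx. Qed.
Lemma fl_jacobi (x y z : freeLie) :
  fl_br x (fl_br y z) + fl_br y (fl_br z x) + fl_br z (fl_br x y) = 0.
Proof.
elim/clsW: x => s; elim/clsW: y => t; elim/clsW: z => u.
rewrite !fl_brE [X in X + _]fl_addE [LHS]fl_addE.
by apply/cls_eq; apply: lcong_jacobi.
Qed.

HB.instance Definition _ :=
  Zmodule_isLie.Build freeLie fl_brDl fl_brDr fl_brxx fl_jacobi.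

Lemma clsD s t : cls (LAdd s t) = cls s + cls t. Proof. by rewrite -fl_addE. Qed.
Lemma clsN s : cls (LOpp s) = - cls s. Proof. by rewrite -fl_oppE. Qed.
Lemma cls0 : cls (LZero n) = 0. Proof. by []. Qed.
Lemma cls_br s t : cls (LBr s t) = [lie cls s, cls t]. Proof. by rewrite -fl_brE. Qed.

Lemma freeLie_ind (P : freeLie -> Prop) :
  (forall i, P (fl_gen i)) -> P 0 -> (forall x, P x -> P (- x)) ->
  (forall x y, P x -> P y -> P (x + y)) ->
  (forall x y, P x -> P y -> P [lie x, y]) -> forall x, P x.
Proof.
move=> Pg P0 PN PD PL; apply: clsW; elim=> [i||s Ps|s Ps t Pt|s Ps t Pt].
- exact: Pg.
- exact: P0.
- by rewrite clsN; apply: PN.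
- by rewrite clsD; apply: PD.
- by rewrite cls_br; apply: PL.
Qed.

Section Lift.
Variables (L : lieType) (g : 'I_n -> L).

Fixpoint lift_term s : L :=
  match s with
  | LGen i => g i
  | LZero => 0
  | LOpp a => - lift_term a
  | LAdd a b => lift_term a + lift_term b
  | LBr a b => [lie lift_term a, lift_term b]
  end.

Definition fl_lift (x : freeLie) : L := lift_term (repr x).

Lemma lift_term_cong s t : lcong s t -> lift_term s = lift_term t.
Proof.
elim=> //=.
- by move=> ? ? ? _ -> _ ->.
- by move=> ? ? _ ->.
- by move=> ? ? ? ? _ -> _ ->.
- by move=> ? ? ? ? _ -> _ ->.
- by move=> *; rewrite addrA.
- by move=> *; rewrite addrC.
- by move=> *; rewrite add0r.
- by move=> *; rewrite addNr.
- by move=> *; rewrite lieDl.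
- by move=> *; rewrite lieDr.
- by move=> *; rewrite liexx.
- by move=> *; rewrite lie_jacobi.
Qed.

Lemma fl_lift_cls s : fl_lift (cls s) = lift_term s.
Proof. exact/lift_term_cong/cls_repr. Qed.

Lemma fl_lift_gen i : fl_lift (fl_gen i) = g i.
Proof. by rewrite fl_lift_cls. Qed.

Lemma fl_lift_is_zmod_morphism : zmod_morphism fl_lift.
Proof.
elim/clsW=> s; elim/clsW=> t.
by rewrite -clsN -clsD !fl_lift_cls.
Qed.

HB.instance Definition _ :=
  GRing.isZmodMorphism.Build freeLie L fl_lift fl_lift_is_zmod_morphism.

Lemma fl_lift_br : lie_morphism fl_lift.
Proof. by elim/clsW=> s; elim/clsW=> t; rewrite -cls_br !fl_lift_cls. Qed.

Lemma fl_lift_uniq (h : {additive freeLie -> L}) : lie_morphism h ->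
  (forall i, h (fl_gen i) = g i) -> h =1 fl_lift.
Proof.
move=> hL hg; elim/freeLie_ind.
- by move=> i; rewrite hg fl_lift_gen.
- by rewrite !raddf0.
- by move=> x hx; rewrite !raddfN hx.
- by move=> x y hx hy; rewrite !raddfD hx hy.
- by move=> x y hx hy; rewrite hL fl_lift_br hx hy.
Qed.

End Lift.

(* Hom(H, L_n): the element \sum_i x_i^* (x) C_i is the function i |-> C_i. *)
Definition der := {ffun 'I_n -> freeLie}.
HB.instance Definition _ := GRing.Zmodule.on der.

Section Extension.
Variable f : der.

Fixpoint der_term s : freeLie :=
  match s with
  | LGen i => f i
  | LZero => 0
  | LOpp a => - der_term a
  | LAdd a b => der_term a + der_term b
  | LBr a b => [lie der_term a, cls b] + [lie cls a, der_term b]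
  end.

(* The derivation of L_n extending f. *)
Definition der_ext (x : freeLie) : freeLie := der_term (repr x).

Lemma der_term_cong s t : lcong s t -> der_term s = der_term t.
Proof.
elim=> //=.
- by move=> ? ? ? _ -> _ ->.
- by move=> ? ? _ ->.
- by move=> ? ? ? ? _ -> _ ->.
- by move=> ? ? ? ? /cls_eq -> -> /cls_eq -> ->.
- by move=> *; rewrite addrA.
- by move=> *; rewrite addrC.
- by move=> *; rewrite add0r.
- by move=> *; rewrite addNr.
- by move=> a b c; rewrite clsD !lieDl addrACA.
- by move=> a b c; rewrite clsD !lieDr addrACA.
- by move=> a; rewrite lieC addNr.
move=> a b c; rewrite !cls_br !lieDr.
set A := cls a; set B := cls b; set C := cls c.
set A' := der_term a; set B' := der_term b; set C' := der_term c.
have JA := lie_jacobi A' B C; have JB := lie_jacobi A B' C.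
have JC := lie_jacobi A B C'.
rewrite (AC ((1*2)*(1*2)*(1*2)) ((1*6*8)*(2*4*9)*(3*5*7))) /=.
by rewrite JA JB JC !addr0.
Qed.

Lemma der_ext_cls s : der_ext (cls s) = der_term s.
Proof. exact/der_term_cong/cls_repr. Qed.

Lemma der_ext_gen i : der_ext (fl_gen i) = f i.
Proof. by rewrite der_ext_cls. Qed.

Lemma der_ext_is_zmod_morphism : zmod_morphism der_ext.
Proof.
elim/clsW=> s; elim/clsW=> t.
by rewrite -clsN -clsD !der_ext_cls.
Qed.

HB.instance Definition _ :=
  GRing.isZmodMorphism.Build freeLie freeLie der_ext der_ext_is_zmod_morphism.

Lemma der_ext_br x y :
  der_ext [lie x, y] = [lie der_ext x, y] + [lie x, der_ext y].
Proof.
by elim/clsW: x => s; elim/clsW: y => t; rewrite -cls_br !der_ext_cls.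
Qed.

End Extension.
End FreeLie.

Section DerLie.
Variable n : nat.
Implicit Types f g : der n.

Lemma der_extDr f x y : der_ext f (x + y) = der_ext f x + der_ext f y.
Proof. exact: raddfD. Qed.

Lemma der_extBr f x y : der_ext f (x - y) = der_ext f x - der_ext f y.
Proof. exact: raddfB. Qed.

Lemma der_extD f g x : der_ext (f + g) x = der_ext f x + der_ext g x.
Proof.
elim/freeLie_ind: x => [i||x Hx|x y Hx Hy|x y Hx Hy].
- by rewrite !der_ext_gen ffunE.
- by rewrite !raddf0 addr0.
- by rewrite !raddfN /= Hx opprD.
- by rewrite !raddfD /= Hx Hy addrACA.
- by rewrite !der_ext_br Hx Hy lieDl lieDr addrACA.
Qed.

(* [f, g] = g \o f - f \o g, on generators. *)
Definition der_br f g : der n :=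
  [ffun i => der_ext g (f i) - der_ext f (g i)].

Lemma der_ext_der_br f g x :
  der_ext (der_br f g) x = der_ext g (der_ext f x) - der_ext f (der_ext g x).
Proof.
elim/freeLie_ind: x => [i||x Hx|x y Hx Hy|x y Hx Hy].
- by rewrite !der_ext_gen ffunE.
- by rewrite !raddf0 addr0.
- by rewrite !raddfN /= Hx opprD.
- by rewrite [LHS]raddfD /= Hx Hy !raddfD /= addrACA.
rewrite !der_ext_br Hx Hy !der_extDr !der_ext_br lieBl lieBr !opprD.
rewrite [RHS](AC ((2*2)*(2*2)) ((1*5*(4*8))*(2*7)*(3*6))) /=.
by rewrite !subrr !addr0.
Qed.

Lemma der_brDl f g h : der_br (f + g) h = der_br f h + der_br g h.
Proof.
by apply/ffunP=> i; rewrite !ffunE raddfD /= der_extD opprD addrACA.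
Qed.

Lemma der_brDr f g h : der_br f (g + h) = der_br f g + der_br f h.
Proof.
by apply/ffunP=> i; rewrite !ffunE raddfD /= der_extD opprD addrACA.
Qed.

Lemma der_brxx f : der_br f f = 0.
Proof. by apply/ffunP=> i; rewrite !ffunE subrr. Qed.

Lemma der_br_jacobi f g h :
  der_br f (der_br g h) + der_br g (der_br h f) + der_br h (der_br f g) = 0.
Proof.
apply/ffunP=> i; rewrite !ffunE !der_ext_der_br !der_extBr !opprB.
rewrite (AC (((2*2)*(2*2))*(2*2))
  ((1*12)*(7*2)*(3*10)*(5*4)*(11*6)*(9*8))) /=.
by rewrite !subrr !addr0.
Qed.

HB.instance Definition _ :=
  Zmodule_isLie.Build (der n) der_brDl der_brDr der_brxx der_br_jacobi.

End DerLie.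

(* The Lie algebra of finitely supported families F = (F@_k), with
   homogeneous components of degrees k and l bracketing into degree k + l. *)
Definition graded (L : lieType) := {malg L[nat]}.

Section Graded.
Variable L : lieType.
HB.instance Definition _ := GRing.Zmodule.on (graded L).
Implicit Types F G K : graded L.


Definition gr_br F G : graded L :=
  \sum_(k <- msupp F) \sum_(l <- msupp G) << [lie F@_k, G@_l] *g (k + l)%N >>.

Lemma gr_brEw (d1 d2 : {fset nat}) F G : (msupp F `<=` d1)%fset -> (msupp G `<=` d2)%fset ->
  gr_br F G = \sum_(k <- d1) \sum_(l <- d2) << [lie F@_k, G@_l] *g (k + l)%N >>.
Proof.
move=> s1 s2; rewrite /gr_br (big_fset_incl _ s1) /=.
  apply: eq_bigr => k _; apply: big_fset_incl => // l _ /mcoeff_outdom ->.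
  by rewrite lie0r monalgU0.
by move=> k _ /mcoeff_outdom ->; apply: big1 => l _; rewrite lie0l monalgU0.
Qed.

Lemma gr_brDl F G K : gr_br (F + G) K = gr_br F K + gr_br G K.
Proof.
pose d := (msupp F `|` msupp G)%fset.
rewrite (@gr_brEw d (msupp K) (F + G)) ?msuppD_le //.
rewrite (@gr_brEw d (msupp K) F) ?fsubsetUl // (@gr_brEw d (msupp K) G) ?fsubsetUr //.
rewrite -big_split; apply: eq_bigr => k _ /=; rewrite -big_split; apply: eq_bigr => l _.
by rewrite mcoeffD lieDl monalgUD.
Qed.

Lemma gr_brDr K F G : gr_br K (F + G) = gr_br K F + gr_br K G.
Proof.
pose d := (msupp F `|` msupp G)%fset.
rewrite (@gr_brEw (msupp K) d K (F + G)) ?msuppD_le //.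
rewrite (@gr_brEw (msupp K) d K F) ?fsubsetUl // (@gr_brEw (msupp K) d K G) ?fsubsetUr //.
rewrite -big_split; apply: eq_bigr => k _ /=; rewrite -big_split; apply: eq_bigr => l _.
by rewrite mcoeffD lieDr monalgUD.
Qed.

Lemma gr_brU a b k l :
  gr_br << a *g k >> << b *g l >> = << [lie a, b] *g (k + l)%N >>.
Proof.
rewrite (@gr_brEw [fset k]%fset [fset l]%fset) ?msuppU_le //.
by rewrite !big_seq_fset1 !mcoeffUU.
Qed.

Lemma graded_ind (P : graded L -> Prop) :
  P 0 -> (forall F G, P F -> P G -> P (F + G)) ->
  (forall k a, P << a *g k >>) -> forall F, P F.
Proof. by move=> P0 PD PU F; rewrite [F]monalgE; apply: big_ind => // k _. Qed.

Lemma gr_br0l F : gr_br 0 F = 0.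
Proof. by apply: (addrI (gr_br 0 F)); rewrite -gr_brDl !addr0. Qed.

Lemma gr_br0r F : gr_br F 0 = 0.
Proof. by apply: (addrI (gr_br F 0)); rewrite -gr_brDr !addr0. Qed.

Lemma gr_brC F G : gr_br F G + gr_br G F = 0.
Proof.
elim/graded_ind: F => [|F F' HF HF'|k a]; first by rewrite gr_br0l gr_br0r addr0.
  by rewrite gr_brDl gr_brDr addrACA HF HF' addr0.
elim/graded_ind: G => [|F F' HF HF'|l b]; first by rewrite gr_br0l gr_br0r addr0.
  by rewrite gr_brDl gr_brDr addrACA HF HF' addr0.
by rewrite !gr_brU addnC -monalgUD lieC addNr monalgU0.
Qed.

Lemma gr_brxx F : gr_br F F = 0.
Proof.
elim/graded_ind: F => [|F F' HF HF'|k a]; first exact: gr_br0l.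
  by rewrite gr_brDl !gr_brDr HF HF' add0r addr0 gr_brC.
by rewrite gr_brU liexx monalgU0.
Qed.

Lemma gr_br_jacobi F G K :
  gr_br F (gr_br G K) + gr_br G (gr_br K F) + gr_br K (gr_br F G) = 0.
Proof.
elim/graded_ind: F => [|F F' HF HF'|k a].
- by rewrite !(gr_br0l, gr_br0r) !addr0.
- rewrite !(gr_brDl, gr_brDr) -[RHS]addr0 -{1}HF -HF'.
  by rewrite [LHS](AC ((2*2)*2) ((1*3*5)*(2*4*6))).
elim/graded_ind: G => [|F F' HF HF'|l b].
- by rewrite !(gr_br0l, gr_br0r) !addr0.
- rewrite !(gr_brDl, gr_brDr) -[RHS]addr0 -{1}HF -HF'.
  by rewrite [LHS](AC ((2*2)*2) ((1*3*5)*(2*4*6))).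
elim/graded_ind: K => [|F F' HF HF'|m c].
- by rewrite !(gr_br0l, gr_br0r) !addr0.
- rewrite !(gr_brDl, gr_brDr) -[RHS]addr0 -{1}HF -HF'.
  by rewrite [LHS](AC ((2*2)*2) ((1*3*5)*(2*4*6))).
rewrite !gr_brU (addnC l (m + k)%N) (addnC m k) addnAC addnA.
rewrite (addnC m (k + l)%N) -!monalgUD lie_jacobi.
by rewrite monalgU0.
Qed.

HB.instance Definition _ :=
  Zmodule_isLie.Build (graded L) gr_brDl gr_brDr gr_brxx gr_br_jacobi.

End Graded.

Section Special.
Variable n : nat.

(* x_i^* (x) [x_{j_1}, ..., x_{j_k}, x_i], where s = (j_1, ..., j_k). *)
Definition pgen (k : nat) (i : 'I_n) (s : k.-tuple 'I_n) : der n :=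
  [ffun j => if j == i then lnorm [seq fl_gen l | l <- rcons s i] else 0].

(* p_n(k), which lies in Hom(H, L_n(k+1)) since its generators do. *)
Definition pn (k : nat) : der n -> Prop :=
  zspan (fun f => exists i, exists s : k.-tuple 'I_n, f = pgen i s).

Definition bn_deg (k : nat) (f : der n) : Prop :=
  pn k f /\ \sum_i f i = 0.

(* The weight k component of L_n. *)
Definition weight (k : nat) : freeLie n -> Prop :=
  zspan (fun x => exists s : k.-tuple 'I_n, x = lnorm [seq fl_gen l | l <- s]).

Lemma tuple_rcons (T : Type) l (s : l.+1.-tuple T) :
  exists s' : l.-tuple T, exists b, s = rcons s' b :> seq T.
Proof.
case/tupleP: s => a s'.
have Ha : size (belast a s') == l by rewrite size_belast size_tuple.
by exists (Tuple Ha), (last a s'); rewrite /= -lastI.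
Qed.

Lemma weight_gen i : weight 1 (fl_gen i).
Proof. by apply: zspan_gen; exists [tuple i]. Qed.

Lemma weight_brgen k x i : (0 < k)%N -> weight k x -> weight k.+1 [lie x, fl_gen i].
Proof.
move=> k0; elim=> [y [s ->]||y z _ Hy _ Hz].
- apply: zspan_gen; exists [tuple of rcons s i]; rewrite /= map_rcons lnorm_rcons //.
  by case: s => -[|a s] //= /eqP Hs; rewrite -Hs in k0.
- by rewrite lie0l; apply: zspan0.
- by rewrite lieBl; apply: zspanB.
Qed.

Lemma weight_br k l x y : (0 < k)%N -> (0 < l)%N ->
  weight k x -> weight l y -> weight (k + l) [lie x, y].
Proof.
move=> k0; elim: l k k0 x y => // l IH k k0 x y _ Hx.
elim=> [z [s ->]||z w _ Hz _ Hw]; first last.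
- by rewrite lieBr; apply: zspanB.
- by rewrite lie0r; apply: zspan0.
have [s' [b ->]] := tuple_rcons s; case: l IH s s' => [|l] IH s s'.
  by rewrite tuple0 /= addn1; apply: weight_brgen.
rewrite map_rcons lnorm_rcons; last by case/tupleP: s'.
rewrite lieA; set u := lnorm _.
have Hu : weight l.+1 u by apply: zspan_gen; exists s'.
apply: zspanB.
  by rewrite addnS; apply: weight_brgen; [rewrite addn_gt0 k0|apply: IH].
by rewrite addnS -addSn; apply: IH => //; apply: weight_brgen.
Qed.

Lemma pnP k f : (0 < k)%N ->
  pn k f <-> exists u : 'I_n -> freeLie n,
    forall i, weight k (u i) /\ f i = [lie u i, fl_gen i].
Proof.
move=> k0; split.
  elim=> [g [i [s ->]]||g h _ [u Hu] _ [v Hv]].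
  - exists (fun j => if j == i then lnorm [seq fl_gen l | l <- s] else 0) => j.
    rewrite ffunE; case: eqP => [->|_].
      split; first by apply: zspan_gen; exists s.
      by rewrite map_rcons lnorm_rcons //; case: s => -[|a s] //= /eqP Hs; rewrite -Hs in k0.
    by rewrite lie0l; split=> //; apply: zspan0.
  - by exists (fun=> 0) => i; rewrite ffunE lie0l; split=> //; apply: zspan0.
  exists (fun i => u i - v i) => i; have [u1 u2] := Hu i; have [v1 v2] := Hv i.
  by rewrite !ffunE lieBl u2 v2; split=> //; apply: zspanB.
case=> u Hu.
have -> : f = \sum_i [ffun j => if j == i then [lie u i, fl_gen i] else 0].
  apply/ffunP=> j; rewrite sum_ffunE (bigD1 j) //= big1 ?addr0.
    by rewrite ffunE eqxx; have [] := Hu j.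
  by move=> i; rewrite ffunE eq_sym => /negPf ->.
apply: zspan_sum => i; have [+ _] := Hu i; elim=> [x [s ->]||x y _ Hx _ Hy].
- apply: zspan_gen; exists i, s; apply/ffunP=> j; rewrite !ffunE map_rcons lnorm_rcons //.
  by case: s => -[|a s] //= /eqP Hs; rewrite -Hs in k0.
- rewrite lie0l; have -> : [ffun j => if j == i then 0 else 0] = 0 :> der n.
    by apply/ffunP=> j; rewrite !ffunE if_same.
  exact: zspan0.
rewrite lieBl.
have := zspanB Hx Hy; congr (zspan _ _).
by apply/ffunP=> j; rewrite !ffunE; case: eqP => // _; rewrite subr0.
Qed.

Lemma der_ext_weight k l f x : (0 < k)%N -> (0 < l)%N ->
  pn k f -> weight l x -> weight (l + k) (der_ext f x).
Proof.
move=> k0 l0 /(pnP _ k0) [u Hu].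
have Hg i : weight k.+1 (der_ext f (fl_gen i)).
  by rewrite der_ext_gen; have [u1 ->] := Hu i; apply: weight_brgen.
elim: l l0 x => // l IH _ x; elim=> [z [s ->]||z w _ Hz _ Hw]; first last.
- by rewrite raddfB; apply: zspanB.
- by rewrite raddf0; apply: zspan0.
have [s' [b ->]] := tuple_rcons s; case: l IH s s' => [|l] IH s s'.
  by rewrite tuple0 /= add1n.
rewrite map_rcons lnorm_rcons; last by case/tupleP: s'.
rewrite der_ext_br; set v := lnorm _.
have Hv : weight l.+1 v by apply: zspan_gen; exists s'.
apply: zspanD.
  by rewrite addSn; apply: weight_brgen => //; apply: IH.
by rewrite addSnnS; apply: weight_br.
Qed.

Lemma pn_br k l f g : (0 < k)%N -> (0 < l)%N ->
  pn k f -> pn l g -> pn (k + l) [lie f, g].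
Proof.
move=> k0 l0 Hf Hg; apply/pnP; first by rewrite addn_gt0 k0.
have [u Hu] := (pnP _ k0).1 Hf; have [v Hv] := (pnP _ l0).1 Hg.
exists (fun i => der_ext g (u i) - der_ext f (v i) + [lie u i, v i]) => i.
have [u1 u2] := Hu i; have [v1 v2] := Hv i; split.
  apply: zspanD; last exact: weight_br.
  by apply: zspanB; [|rewrite addnC]; apply: der_ext_weight.
rewrite ffunE u2 v2 !der_ext_br !der_ext_gen u2 v2 lieDl lieBl opprD.
rewrite [LHS]addrACA; congr (_ + _).
by rewrite (lieA (u i)) (lieC (v i) [lie u i, _]) opprK subrK.
Qed.

Lemma bn_deg_br k l f g : (0 < k)%N -> (0 < l)%N ->
  bn_deg k f -> bn_deg l g -> bn_deg (k + l) [lie f, g].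
Proof.
move=> k0 l0 [pf sf] [pg sg]; split; first exact: pn_br.
under eq_bigr do rewrite ffunE.
rewrite sumrB.
have -> : \sum_i der_ext g (f i) = der_ext g (\sum_i f i) by rewrite raddf_sum.
have -> : \sum_i der_ext f (g i) = der_ext f (\sum_i g i) by rewrite raddf_sum.
by rewrite sf sg !raddf0 ?addr0.
Qed.

Lemma bn_deg0 k : bn_deg k 0.
Proof. by split; [apply: zspan0 | rewrite big1 // => i _; rewrite ffunE]. Qed.

Lemma bn_degB k f g : bn_deg k f -> bn_deg k g -> bn_deg k (f - g).
Proof.
move=> [pf sf] [pg sg]; split; first exact: zspanB.
by under eq_bigr do rewrite !ffunE; rewrite sumrB sf sg subrr.
Qed.

Definition bn_deg_pred (k : nat) : {pred der n} := fun f => `[< bn_deg k f >].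

Lemma bn_deg_zmod_closed k : zmod_closed (bn_deg_pred k).
Proof.
split; first by apply/asboolP; apply: bn_deg0.
by move=> f g /asboolP Hf /asboolP Hg; apply/asboolP; apply: bn_degB.
Qed.
HB.instance Definition _ k :=
  GRing.isZmodClosed.Build (der n) (bn_deg_pred k) (bn_deg_zmod_closed k).

(* The (external) direct sum of the b_n(k), k >= 1; there is no degree 0 part. *)
Definition bn_pred : {pred graded (der n)} :=
  fun F => `[< F@_0 = 0 /\ forall k, (0 < k)%N -> bn_deg k F@_k >].

Lemma bn_zmod_closed : zmod_closed bn_pred.
Proof.
split.
  by apply/asboolP; split=> [|k _]; rewrite mcoeff0 //; apply: bn_deg0.
move=> F G /asboolP[F0 Fk] /asboolP[G0 Gk]; apply/asboolP; split=> [|k k0].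
  by rewrite mcoeffB F0 G0 subrr.
by rewrite mcoeffB; apply: bn_degB; [apply: Fk | apply: Gk].
Qed.
HB.instance Definition _ :=
  GRing.isZmodClosed.Build (graded (der n)) bn_pred bn_zmod_closed.

Lemma bn_br_closed F G : F \in bn_pred -> G \in bn_pred -> [lie F, G] \in bn_pred.
Proof.
move=> /asboolP[F0 Fk] /asboolP[G0 Gk].
apply: rpred_sum => k _; apply: rpred_sum => l _.
have [->|k0] := posnP k; first by rewrite F0 lie0l monalgU0 rpred0.
have [->|l0] := posnP l; first by rewrite G0 lie0r monalgU0 rpred0.
apply/asboolP; split=> [|m m0]; rewrite mcoeffU.
  by rewrite addn_eq0 -!leqn0 leqNgt k0.
case: eqP => [<-|_]; last exact: bn_deg0.
by apply: bn_deg_br; [| | apply: Fk | apply: Gk].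
Qed.

Definition bn := zsub bn_pred.
HB.instance Definition _ := GRing.Zmodule.on bn.

Definition bn_br (F G : bn) : bn :=
  exist _ [lie \val F, \val G] (bn_br_closed (valP F) (valP G)).

Lemma bn_brDl F G K : bn_br (F + G) K = bn_br F K + bn_br G K.
Proof. by apply: val_inj; rewrite /= lieDl. Qed.
Lemma bn_brDr F G K : bn_br F (G + K) = bn_br F G + bn_br F K.
Proof. by apply: val_inj; rewrite /= lieDr. Qed.
Lemma bn_brxx F : bn_br F F = 0.
Proof. by apply: val_inj; rewrite /= liexx. Qed.
Lemma bn_br_jacobi F G K :
  bn_br F (bn_br G K) + bn_br G (bn_br K F) + bn_br K (bn_br F G) = 0.
Proof. by apply: val_inj; rewrite /= lie_jacobi. Qed.

HB.instance Definition _ :=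
  Zmodule_isLie.Build bn bn_brDl bn_brDr bn_brxx bn_br_jacobi.

End Special.

Definition abelianLie (V : zmodType) : Type := V.

Section Abelian.
Variable V : zmodType.
HB.instance Definition _ := GRing.Zmodule.on (abelianLie V).
Let br0 (_ _ : abelianLie V) : abelianLie V := 0.
Let br0Dl a b c : br0 (a + b) c = br0 a c + br0 b c. Proof. by rewrite addr0. Qed.
Let br0Dr a b c : br0 a (b + c) = br0 a b + br0 a c. Proof. by rewrite addr0. Qed.
Let br0xx a : br0 a a = 0. Proof. by []. Qed.
Let br0_jacobi a b c : br0 a (br0 b c) + br0 b (br0 c a) + br0 c (br0 a b) = 0.
Proof. by rewrite !addr0. Qed.
HB.instance Definition _ :=
  Zmodule_isLie.Build (abelianLie V) br0Dl br0Dr br0xx br0_jacobi.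
End Abelian.

Section Abelianization.
Variable L : lieType.

Definition derived : {pred L} :=
  fun x => `[< zspan (fun y => exists a b, y = [lie a, b]) x >].

Lemma derived_zmod_closed : zmod_closed derived.
Proof.
split; first by apply/asboolP; apply: zspan0.
by move=> x y /asboolP Hx /asboolP Hy; apply/asboolP; apply: zspanB.
Qed.
HB.instance Definition _ := GRing.isZmodClosed.Build L derived derived_zmod_closed.

Definition H1 := Quotient.quot derived.
HB.instance Definition _ := GRing.Zmodule.on H1.
HB.instance Definition _ := EqQuotient.on H1.

Definition H1_pi : L -> H1 := \pi_(Quotient.quot derived).

Lemma H1_pi_is_zmod_morphism : zmod_morphism H1_pi.
Proof. exact: raddfB. Qed.
HB.instance Definition _ :=
  GRing.isZmodMorphism.Build L H1 H1_pi H1_pi_is_zmod_morphism.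

Definition H1_br (x y : H1) : H1 := H1_pi [lie repr x, repr y].

Lemma H1_pi_br a b : H1_pi [lie a, b] = 0.
Proof.
apply/eqP; rewrite -(raddf0 H1_pi) -Quotient.idealrBE subr0.
by apply/asboolP; apply: zspan_gen; exists a, b.
Qed.

Let H1_br0 x y : H1_br x y = 0. Proof. exact: H1_pi_br. Qed.
Let H1_brDl x y z : H1_br (x + y) z = H1_br x z + H1_br y z.
Proof. by rewrite !H1_br0 addr0. Qed.
Let H1_brDr x y z : H1_br x (y + z) = H1_br x y + H1_br x z.
Proof. by rewrite !H1_br0 addr0. Qed.
Let H1_brxx x : H1_br x x = 0. Proof. exact: H1_br0. Qed.
Let H1_jacobi x y z :
  H1_br x (H1_br y z) + H1_br y (H1_br z x) + H1_br z (H1_br x y) = 0.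
Proof. by rewrite !H1_br0 !addr0. Qed.
HB.instance Definition _ := Zmodule_isLie.Build H1 H1_brDl H1_brDr H1_brxx H1_jacobi.

Lemma H1_pi_morph : lie_morphism H1_pi.
Proof. by move=> a b; rewrite H1_pi_br [RHS]H1_br0. Qed.

End Abelianization.

Definition commLie (R : pzRingType) : Type := R.

Section Commutator.
Variable R : pzRingType.
HB.instance Definition _ := GRing.Zmodule.on (commLie R).
Let com (a b : commLie R) : commLie R := (a : R) * b - (b : R) * a.
Let comDl a b c : com (a + b) c = com a c + com b c.
Proof. by rewrite /com mulrDl mulrDr opprD addrACA. Qed.
Let comDr a b c : com a (b + c) = com a b + com a c.
Proof. by rewrite /com mulrDl mulrDr opprD addrACA. Qed.
Let comxx a : com a a = 0. Proof. exact: subrr. Qed.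
Let com_jacobi a b c : com a (com b c) + com b (com c a) + com c (com a b) = 0.
Proof.
rewrite /com !mulrBl !mulrBr !mulrA !opprB.
rewrite (AC (((2*2)*(2*2))*(2*2))
  ((1*12)*(2*7)*(3*10)*(4*5)*(6*11)*(8*9))) /=.
by rewrite ?subrr ?addNr !addr0.
Qed.
HB.instance Definition _ := Zmodule_isLie.Build (commLie R) comDl comDr comxx com_jacobi.
End Commutator.

Section Trace.
Variable n : nat.

(* The tensor algebra T(H), with basis the words in x_1, ..., x_n. *)
Definition tens := {malg int[{fmonom 'I_n}]}.
(* The symmetric algebra S(H) = Z[x_1, ..., x_n]. *)
Definition sym := {malg int[{cmonom 'I_n}]}.
HB.instance Definition _ := GRing.NzRing.on tens.
HB.instance Definition _ := GRing.ComNzRing.on sym.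

Definition embed (x : freeLie n) : tens :=
  fl_lift (fun i => << fmu i >> : commLie tens) x.

(* x_i^* (x) x_{j_1} (x) ... (x) x_{j_k+1} |->
   x_i^*(x_{j_1}) x_{j_2} (x) ... (x) x_{j_k+1}. *)
Definition contract (i : 'I_n) (t : tens) : tens :=
  \sum_(w <- msupp t)
    if fmonom_val w is j :: w' then << t@_w *+ (i == j) *g FMonom w' >> else 0.

Definition proj_sym (t : tens) : sym :=
  \sum_(w <- msupp t) t@_w *: \prod_(j <- fmonom_val w) << ucm j >>.

(* The restriction of MT to Hom(H, L_n(k+1)) is MT_k, with values in the
   degree k part S^k H of S(H). *)
Definition MT (f : der n) : sym := \sum_i proj_sym (contract i (embed (f i))).

Lemma embed_is_zmod_morphism : zmod_morphism embed.
Proof. by move=> x y; rewrite /embed raddfB. Qed.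
HB.instance Definition _ :=
  GRing.isZmodMorphism.Build (freeLie n) tens embed embed_is_zmod_morphism.

Lemma contractEw (d : {fset {fmonom 'I_n}}) i t : (msupp t `<=` d)%fset ->
  contract i t = \sum_(w <- d)
    if fmonom_val w is j :: w' then << t@_w *+ (i == j) *g FMonom w' >> else 0.
Proof.
move=> le; apply: big_fset_incl => // w _ /mcoeff_outdom ->.
by case: (fmonom_val w) => // j w'; rewrite mul0rn monalgU0.
Qed.

Lemma contract_is_zmod_morphism i : zmod_morphism (contract i).
Proof.
move=> s t; pose d := (msupp s `|` msupp t)%fset.
rewrite !(@contractEw d) ?fsubsetUl ?fsubsetUr ?msuppB_le //.
rewrite -sumrB; apply: eq_bigr => w _; case: (fmonom_val w) => [|j w'].
  by rewrite subr0.
by rewrite mcoeffB mulrnBl monalgUB.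
Qed.
HB.instance Definition _ i :=
  GRing.isZmodMorphism.Build tens tens (contract i) (contract_is_zmod_morphism i).

Lemma proj_symEw (d : {fset {fmonom 'I_n}}) t : (msupp t `<=` d)%fset ->
  proj_sym t = \sum_(w <- d) t@_w *: \prod_(j <- fmonom_val w) << ucm j >>.
Proof.
by move=> le; apply: big_fset_incl => // w _ /mcoeff_outdom ->; rewrite scale0r.
Qed.

Lemma proj_sym_is_zmod_morphism : zmod_morphism proj_sym.
Proof.
move=> s t; pose d := (msupp s `|` msupp t)%fset.
rewrite !(@proj_symEw d) ?fsubsetUl ?fsubsetUr ?msuppB_le //.
by rewrite -sumrB; apply: eq_bigr => w _; rewrite mcoeffB scalerBl.
Qed.
HB.instance Definition _ :=
  GRing.isZmodMorphism.Build tens sym proj_sym proj_sym_is_zmod_morphism.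

Lemma MT_is_zmod_morphism : zmod_morphism MT.
Proof.
move=> f g; rewrite /MT -sumrB; apply: eq_bigr => i _.
by rewrite !ffunE !raddfB.
Qed.
HB.instance Definition _ :=
  GRing.isZmodMorphism.Build (der n) sym MT MT_is_zmod_morphism.

(* Im(MT_k^B) *)
Definition imMT (k : nat) (p : sym) : Prop := exists2 f, bn_deg k f & MT f = p.

(* P@_m lies in the summand Im(MT_{2m+1}^B), m >= 1; index 0 is unused. *)
Definition imsum_pred : {pred {malg sym[nat]}} :=
  fun P => `[< P@_0 = 0 /\ forall m, (0 < m)%N -> imMT m.*2.+1 P@_m >].

Lemma imMT0 k : imMT k 0.
Proof. by exists 0; [apply: bn_deg0 | apply: raddf0]. Qed.

Lemma imsum_zmod_closed : zmod_closed imsum_pred.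
Proof.
split.
  by apply/asboolP; split=> [|m _]; rewrite mcoeff0 //; apply: imMT0.
move=> P Q /asboolP[P0 Pm] /asboolP[Q0 Qm]; apply/asboolP; split=> [|m m0].
  by rewrite mcoeffB P0 Q0 subrr.
have [f bf Ef] := Pm m m0; have [g bg Eg] := Qm m m0.
by exists (f - g); [apply: bn_degB | rewrite mcoeffB -Ef -Eg raddfB].
Qed.
HB.instance Definition _ :=
  GRing.isZmodClosed.Build {malg sym[nat]} imsum_pred imsum_zmod_closed.

Definition Theta_target : Type :=
  abelianLie (zsub (bn_deg_pred (n:=n) 1) * zsub imsum_pred)%type.
HB.instance Definition _ := Lie.on Theta_target.

Lemma Theta1_proof (F : bn n) : (\val F)@_1 \in bn_deg_pred 1.
Proof. by have /asboolP[_ Fk] := valP F; apply/asboolP; apply: Fk. Qed.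

(* The m-th component is MT_{2m+1} of the component of degree 2m+1; the set
   {k./2 | k in msupp F} contains all m for which it can be nonzero. *)
Definition trace_seq (F : graded (der n)) : {malg sym[nat]} :=
  [malg m in [fset k./2 | k in msupp F]%fset =>
     if m == 0%N then 0 else MT F@_m.*2.+1].

Lemma trace_seqE F m : (trace_seq F)@_m = if m == 0%N then 0 else MT F@_m.*2.+1.
Proof.
rewrite mcoeffE; case: ifP => // /negP Hm; case: eqP => // _.
rewrite mcoeff_outdom ?raddf0 //; apply/negP => Hk; apply: Hm.
by apply/imfsetP; exists m.*2.+1; rewrite //= uphalf_double.
Qed.

Lemma Theta2_proof (F : bn n) : trace_seq (\val F) \in imsum_pred.
Proof.
have /asboolP[_ Fk] := valP F; apply/asboolP; split=> [|m m0]; rewrite trace_seqE //.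
by rewrite eqn0Ngt m0 /=; exists (\val F)@_m.*2.+1 => //; apply: Fk.
Qed.

Definition Theta (F : bn n) : Theta_target :=
  (exist (fun f => f \in bn_deg_pred 1) (\val F)@_1 (Theta1_proof F),
   exist (fun P => P \in imsum_pred) (trace_seq (\val F)) (Theta2_proof F)).

Lemma trace_seqB F G : trace_seq (F - G) = trace_seq F - trace_seq G.
Proof.
apply/malgP=> m; refine (etrans (trace_seqE (F - G) m) _).
refine (esym (etrans (mcoeffB m (trace_seq F) (trace_seq G)) _)).
refine (etrans (congr2 (fun x y => x - y) (trace_seqE F m) (trace_seqE G m)) _).
case: (m == 0%N); first exact: subr0.
exact: (etrans (esym (raddfB MT _ _)) (congr1 MT (esym (mcoeffB m.*2.+1 F G)))).
Qed.

Lemma Theta_is_zmod_morphism : zmod_morphism Theta.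
Proof.
move=> F G; congr pair; apply: val_inj.
  exact: (mcoeffB 1 (\val F) (\val G)).
exact: (trace_seqB (\val F) (\val G)).
Qed.
HB.instance Definition _ :=
  GRing.isZmodMorphism.Build (bn n) Theta_target Theta Theta_is_zmod_morphism.

Lemma Theta_fstE (F : bn n) : \val (Theta F).1 = (\val F)@_1.
Proof. by []. Qed.

Lemma Theta_sndE (F : bn n) m : (0 < m)%N ->
  (\val (Theta F).2)@_m = MT (\val F)@_m.*2.+1.
Proof. by case: m => // m _; apply: trace_seqE. Qed.

End Trace.

(* Main.v *)
Require Import Defs.
From HB Require Import structures.
From mathcomp Require Import all_boot all_order all_algebra.
From mathcomp Require Import finmap boolp zify.
From mathcomp.multinomials Require Import monalg.

Set Implicit Arguments.
Unset Strict Implicit.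
Unset Printing Implicit Defensive.

Import GRing.Theory.
Local Open Scope ring_scope.

(** An explicit class of degree 7 lies in the kernel, and two generators are
    enough to see that it is not zero.

    Traces only see the metabelian quotient.  Composed with the embedding in
    the tensor algebra and the projection to the symmetric algebra, the
    contraction by [x_i^*] becomes a Fox derivative [D_i] of the free Lie
    algebra: [D_i [a, b] = D_i a * l b - D_i b * l a], where [l] is the linear
    part, which vanishes on brackets.  Hence
    - a derivation [g] of positive degree satisfies the chain rule
      [D_i (g a) = \sum_j D_j a * D_i (g x_j)], so the trace of a bracket is
      the difference of two equal double sums ([div_br], [MT_br]) and [Theta]
      factors through the abelianization ([Theta_br], [H1_lift_exists]);
    - [D_i] and [l] vanish on the second derived algebra.

    The class.  Put [a = [x, y]], [b = [a, x]], [c = [a, y]] with [x = x_1] and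
    [y = x_2].  The planar tree with three branches [a], [b], [c] at its centre
    defines a special derivation [tripod]: the value [u_i] attached to [x_i] is
    the sum, over the leaves labelled [x_i], of the tree rooted at that leaf,
    and [\sum_i [u_i, x_i] = 0] is the Jacobi identity for [a], [b], [c]
    carried to the leaves ([tripod_sum]).  The tree is not a caterpillar, so
    each [u_i] lies in the second derived algebra and the trace is zero
    ([MT_tripod]).

    Why it is not a sum of brackets.  Killing [x_3, ..., x_n] maps special
    derivations on [n] generators to special derivations on two generators,
    compatibly with brackets ([der_restr_br], [der_restr_bn]).  On two
    generators nothing is left in degrees 2 and 4 ([bn2_deg2], [bn2_deg4]),
    and in degree 1 only the multiples of the inner derivation by [x + y]
    ([bn2_deg1]), which is central because special derivations annihilate
    [x + y] ([br_inner]).  A bracket of total degree 7 has a factor of degree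
    1, 2 or 4, so all such brackets vanish after the restriction
    ([bn2_br_deg7]), whereas the restriction of [tripod] is not zero: one of
    its coefficients in the tensor algebra is [-3] ([tripod_x_neq0]).

    The vanishing statements in low degree are obtained from a spanning family
    of each weight and from coefficients of words in the tensor algebra; the
    latter are computed from the syntax of Lie terms ([wcoef_expand]), and the
    injectivity of the embedding is never invoked. *)

(** * Integer multiples in a Lie algebra *)

Section LieMultiples.
Variable L : lieType.

Lemma lieMnl (a b : L) m : [lie a *+ m, b] = [lie a, b] *+ m.
Proof. by elim: m => [|m IH]; rewrite ?mulr0n ?lie0l // !mulrS lieDl IH. Qed.

Lemma lieMzl (a b : L) (c : int) : [lie a *~ c, b] = [lie a, b] *~ c.
Proof. by case: c => m; rewrite ?NegzE ?mulrNz ?lieNl -!pmulrn lieMnl. Qed.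

Lemma lieMzr (a b : L) (c : int) : [lie a, b *~ c] = [lie a, b] *~ c.
Proof. by rewrite lieC lieMzl -mulNrz -lieC. Qed.
End LieMultiples.

(** * Fox calculus and the Morita trace *)

Section FoxCalculus.
Variables (n : nat) (R : comNzRingType).
Variables (lin : {additive freeLie n -> R}) (D : 'I_n -> {additive freeLie n -> R}).
Hypothesis lin_br : forall a b, lin [lie a, b] = 0.
Hypothesis D_br : forall i a b, D i [lie a, b] = D i a * lin b - D i b * lin a.
Hypothesis D_gen : forall i j, D i (fl_gen j) = (i == j)%:R.
Implicit Types (a b : freeLie n) (f g : der n).

Lemma lin_der f a : (forall i, lin (f i) = 0) -> lin (der_ext f a) = 0.
Proof.
move=> Hf; elim/freeLie_ind: a => [i||a Ha|a b Ha Hb|a b Ha Hb].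
- by rewrite der_ext_gen.
- by rewrite !raddf0.
- by rewrite !raddfN /= Ha oppr0.
- by rewrite !raddfD /= Ha Hb addr0.
- by rewrite der_ext_br raddfD /= !lin_br addr0.
Qed.

(** Chain rule: both sides obey the rule [D_br] and agree on generators. *)
Lemma fox_der f i a : (forall j, lin (f j) = 0) ->
  D i (der_ext f a) = \sum_j D j a * D i (f j).
Proof.
move=> Hf; elim/freeLie_ind: a => [j||a Ha|a b Ha Hb|a b Ha Hb].
- rewrite der_ext_gen (bigD1 j) //= big1 ?addr0 ?D_gen ?eqxx ?mul1r //.
  by move=> k /negPf kj; rewrite D_gen kj mul0r.
- by rewrite !raddf0 big1 // => j _; rewrite raddf0 mul0r.
- by rewrite !raddfN /= Ha -sumrN; apply: eq_bigr => j _; rewrite raddfN mulNr.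
- by rewrite !raddfD /= Ha Hb -big_split; apply: eq_bigr => j _; rewrite raddfD mulrDl.
rewrite der_ext_br raddfD /= !D_br !(@lin_der f) // !mulr0 subr0 sub0r Ha Hb.
rewrite !mulr_suml -sumrB; apply: eq_bigr => j _; rewrite D_br mulrBl.
by rewrite mulrAC [X in _ = _ - X]mulrAC.
Qed.

(** By the chain rule the two halves of [[lie f, g]] contribute the traces of
    the products, in the two orders, of the Jacobian matrices of [f] and [g]. *)
Lemma div_br f g : (forall i, lin (f i) = 0) -> (forall i, lin (g i) = 0) ->
  \sum_i D i ([lie f, g] i) = 0.
Proof.
move=> Hf Hg.
under eq_bigr => i _ do rewrite ffunE raddfB /= !fox_der //.
rewrite sumrB exchange_big /=; apply/eqP; rewrite subr_eq0; apply/eqP.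
by apply: eq_bigr => i _; apply: eq_bigr => j _; rewrite mulrC.
Qed.
End FoxCalculus.

Section MoritaTrace.
Variable n : nat.
Implicit Types (a b : freeLie n) (s t : tens n) (i j : 'I_n) (f g : der n).

Lemma tens_ind (P : tens n -> Prop) :
  P 0 -> (forall s t, P s -> P t -> P (s + t)) ->
  (forall (c : int) w, P << c *g FMonom w >>) -> forall s, P s.
Proof.
move=> P0 PD PU s; have -> : s = \sum_(k <- msupp s) << s@_k *g k >> by exact: monalgE.
by apply: big_ind => // -[w] _.
Qed.

Lemma tens_wordM (c d : int) v w :
  << c *g FMonom v >> * << d *g FMonom w >> = << c * d *g FMonom (v ++ w) >> :> tens n.
Proof.
rewrite [LHS]malgM_def fgmulUU; congr << _ *g _ >>; exact: fmmulE.
Qed.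

Lemma embed_gen i : embed (fl_gen i) = << fmu i >> :> tens n.
Proof. exact: (@fl_lift_gen n (commLie (tens n))). Qed.

Lemma embed_br a b : embed [lie a, b] = embed a * embed b - embed b * embed a.
Proof. exact: (@fl_lift_br n (commLie (tens n))). Qed.

Lemma proj_symU (c : int) (m : {fmonom 'I_n}) :
  proj_sym << c *g m >> = c *: \prod_(j <- fmonom_val m) << ucm j >> :> sym n.
Proof. by rewrite (@proj_symEw _ [fset m]%fset) ?msuppU_le // big_seq_fset1 mcoeffUU. Qed.

Lemma proj_symM s t : proj_sym (s * t) = proj_sym s * proj_sym t.
Proof.
elim/tens_ind: s => [|s s' Hs Hs'|c v]; first by rewrite mul0r raddf0 mul0r.
  rewrite mulrDl 2!(raddfD (@proj_sym n)) [RHS]mulrDl.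
  by congr (_ + _); [exact: Hs|exact: Hs'].
elim/tens_ind: t => [|t t' Ht Ht'|d w]; first by rewrite mulr0 raddf0 mulr0.
  rewrite mulrDr 2!(raddfD (@proj_sym n)) [RHS]mulrDr.
  by congr (_ + _); [exact: Ht|exact: Ht'].
rewrite tens_wordM !proj_symU big_cat /=.
by rewrite -scalerAl -scalerAr scalerA.
Qed.

Definition wcoef (w : seq 'I_n) (t : tens n) : int := t@_(FMonom w).

Fact wcoef_is_zmod_morphism w : zmod_morphism (wcoef w).
Proof. by move=> s t; apply: mcoeffB. Qed.
HB.instance Definition _ w :=
  GRing.isZmodMorphism.Build (tens n) int (wcoef w) (wcoef_is_zmod_morphism w).

Lemma wcoefU v (c : int) w : wcoef w << c *g FMonom v >> = c *+ (v == w).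
Proof. by rewrite /wcoef mcoeffU. Qed.

Lemma wcoef_nilM s t : wcoef [::] (s * t) = wcoef [::] s * wcoef [::] t.
Proof.
elim/tens_ind: s => [|s s' Hs Hs'|c v]; first by rewrite mul0r raddf0 mul0r.
  rewrite mulrDl 2!(raddfD (wcoef _)) [RHS]mulrDl.
  by congr (_ + _); [exact: Hs|exact: Hs'].
elim/tens_ind: t => [|t t' Ht Ht'|d w]; first by rewrite mulr0 raddf0 mulr0.
  rewrite mulrDr 2!(raddfD (wcoef _)) [RHS]mulrDr.
  by congr (_ + _); [exact: Ht|exact: Ht'].
by rewrite tens_wordM !wcoefU; case: v w => [|? ?] [|? ?]; rewrite ?mulr0n ?mulr0 ?mul0r.
Qed.

Lemma contractU i (c : int) w :
  contract i << c *g FMonom w >> =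
  if w is j :: w' then << c *+ (i == j) *g FMonom w' >> else 0.
Proof.
by rewrite (@contractEw _ [fset FMonom w]%fset) ?msuppU_le // big_seq_fset1 mcoeffUU.
Qed.

(** Contraction consumes the first letter of a word, which belongs to [s] when
    [s] has no constant term. *)
Lemma contractM i s t : wcoef [::] s = 0 -> contract i (s * t) = contract i s * t.
Proof.
(* The general formula, with a correction by the constant term, is biadditive. *)
suff H : contract i (s * t) =
    contract i s * t + contract i (<< wcoef [::] s *g FMonom [::] >> * t).
  by move=> s0; rewrite H s0 [<< _ *g _ >>]monalgU0 mul0r raddf0 addr0.
elim/tens_ind: s => [|s s' Hs Hs'|c v].
- by rewrite (raddf0 (wcoef _)) [<< _ *g _ >>]monalgU0 mul0r !raddf0 !mul0r addr0.
- rewrite (raddfD (wcoef _)) [<< _ *g _ >>]monalgUD.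
  rewrite [in LHS]mulrDl [LHS](raddfD (contract i)) (raddfD (contract i) s).
  rewrite [X in _ = X + _]mulrDl [X in _ + contract i X]mulrDl.
  rewrite [X in _ = _ + X](raddfD (contract i)).
  rewrite [RHS]addrACA.
  by congr (_ + _); [exact: Hs|exact: Hs'].
elim/tens_ind: t => [|t t' Ht Ht'|d w].
- by rewrite !mulr0 !raddf0 addr0.
- rewrite [in LHS]mulrDr [X in _ = X + _]mulrDr [X in _ + contract i X]mulrDr.
  rewrite [LHS](raddfD (contract i)) [X in _ = _ + X](raddfD (contract i)).
  rewrite [RHS]addrACA.
  by congr (_ + _); [exact: Ht|exact: Ht'].
rewrite wcoefU !tens_wordM !contractU.
case: v => [|j v] /=; first by rewrite mul0r add0r mulr1n.
rewrite mulr0n mul0r tens_wordM -mulrnAl.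
by case: w => [|k w]; rewrite ?mul0rn ?[X in _ + X]monalgU0 addr0.
Qed.

Lemma embed_const a : wcoef [::] (embed a) = 0.
Proof.
elim/freeLie_ind: a => [i||a Ha|a b Ha Hb|a b Ha Hb].
- by rewrite embed_gen fmuE wcoefU.
- by rewrite !raddf0.
- by rewrite !raddfN /= Ha oppr0.
- by rewrite !raddfD /= Ha Hb addr0.
rewrite embed_br; move: (embed a) (embed b) Ha Hb => s t Hs Ht.
rewrite (raddfB (wcoef _)) [X in X - _]wcoef_nilM [X in _ - X]wcoef_nilM.
by rewrite Hs Ht mul0r subrr.
Qed.

(** The linear part, and the Fox derivatives, of the abelianized embedding:
    [MT f] is the divergence [\sum_i lfox i (f i)]. *)
Definition linpart a : sym n := proj_sym (embed a).
Definition lfox i a : sym n := proj_sym (contract i (embed a)).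

Fact linpart_is_zmod_morphism : zmod_morphism linpart.
Proof. by move=> a b; rewrite /linpart !raddfB. Qed.
HB.instance Definition _ :=
  GRing.isZmodMorphism.Build (freeLie n) (sym n) linpart linpart_is_zmod_morphism.

Fact lfox_is_zmod_morphism i : zmod_morphism (lfox i).
Proof. by move=> a b; rewrite /lfox !raddfB. Qed.
HB.instance Definition _ i :=
  GRing.isZmodMorphism.Build (freeLie n) (sym n) (lfox i) (lfox_is_zmod_morphism i).

Lemma linpart_br a b : linpart [lie a, b] = 0.
Proof.
rewrite /linpart embed_br; move: (embed a) (embed b) => s t.
rewrite (raddfB (@proj_sym n)) [X in X - _]proj_symM [X in _ - X]proj_symM.
by rewrite [X in _ - X]mulrC subrr.
Qed.

Lemma lfox_br i a b :
  lfox i [lie a, b] = lfox i a * linpart b - lfox i b * linpart a.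
Proof.
rewrite /lfox /linpart embed_br.
move: (embed a) (embed b) (embed_const a) (embed_const b) => s t Hs Ht.
rewrite (raddfB (contract i)) (raddfB (@proj_sym n)).
by congr (_ - _); apply: etrans (proj_symM _ _); congr (proj_sym _); apply: contractM.
Qed.

Lemma lfox_gen i j : lfox i (fl_gen j) = (i == j)%:R.
Proof.
rewrite /lfox embed_gen fmuE contractU /= proj_symU big_nil.
by case: (i == j); rewrite ?mulr1n ?scale1r ?scale0r.
Qed.

(** Derivations in [pn] of positive degree take values in brackets, where the
    linear part vanishes. *)
Lemma MT_br k l f g : pn k.+1 f -> pn l.+1 g -> MT [lie f, g] = 0.
Proof.
have Hlin m h i : pn m.+1 h -> linpart (h i) = 0.
  by case/pnP=> // u /(_ i) [_ ->]; apply: linpart_br.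
move=> Hf Hg; apply: (div_br linpart_br lfox_br lfox_gen) => i.
  exact: Hlin Hf.
exact: Hlin Hg.
Qed.
End MoritaTrace.

(** * Coefficients of words *)

Section Words.
Local Open Scope quotient_scope.
Variable n : nat.
Implicit Types (s : lterm n) (w : seq 'I_n) (e : seq (seq 'I_n * int)).

(** The unreduced expansion of a Lie term: the same word may occur several times. *)
Fixpoint expand s : seq (seq 'I_n * int) :=
  match s with
  | LGen i => [:: ([:: i], 1)]
  | LZero => [::]
  | LOpp a => [seq (p.1, - p.2) | p <- expand a]
  | LAdd a b => expand a ++ expand b
  | LBr a b => [seq (p.1 ++ q.1, p.2 * q.2) | p <- expand a, q <- expand b]
      ++ [seq (p.1 ++ q.1, - (p.2 * q.2)) | p <- expand b, q <- expand a]
  end.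

Definition tens_of e : tens n := \sum_(p <- e) << p.2 *g FMonom p.1 >>.

Lemma tens_of_cat e1 e2 : tens_of (e1 ++ e2) = tens_of e1 + tens_of e2.
Proof. exact: big_cat. Qed.

Lemma tens_ofM e1 e2 :
  tens_of e1 * tens_of e2 =
  tens_of [seq (p.1 ++ q.1, p.2 * q.2) | p <- e1, q <- e2].
Proof.
rewrite /tens_of big_allpairs_dep big_distrl; apply: eq_bigr => p _.
rewrite big_distrr; apply: eq_bigr => q _; exact: tens_wordM.
Qed.

Lemma tens_of_opp e : tens_of [seq (p.1, - p.2) | p <- e] = - tens_of e.
Proof.
rewrite /tens_of big_map -sumrN; apply: eq_bigr => p _; exact: monalgUN.
Qed.

Lemma embed_expand s : embed (\pi_(freeLie n) s) = tens_of (expand s).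
Proof.
elim: s => [i||s IH|s IHs t IHt|s IHs t IHt] /=.
- by rewrite embed_gen fmuE /tens_of big_seq1.
- by rewrite cls0 raddf0 /tens_of big_nil.
- by rewrite clsN raddfN /= IH tens_of_opp.
- by rewrite clsD raddfD /= IHs IHt tens_of_cat.
rewrite cls_br embed_br IHs IHt tens_of_cat; congr (_ + _); first exact: tens_ofM.
rewrite [X in - X]tens_ofM -tens_of_opp; congr tens_of.
by rewrite map_allpairs.
Qed.

Lemma cls_lift_term s : \pi_(freeLie n) s = lift_term (@fl_gen n) s.
Proof.
by elim: s => //= [s <-|s <- t <-|s <- t <-]; rewrite ?clsN ?clsD ?cls_br.
Qed.

(** A [foldr], so that the coefficient is evaluated by conversion. *)
Definition word_count w e : int := foldr (fun p c => p.2 *+ (p.1 == w) + c) 0 e.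

Lemma wcoef_expand w s :
  wcoef w (embed (lift_term (@fl_gen n) s)) = word_count w (expand s).
Proof.
rewrite -cls_lift_term embed_expand /tens_of (raddf_sum (wcoef w)).
by elim: (expand s) => [|p e IH]; rewrite ?big_nil // big_cons IH /= wcoefU.
Qed.

Definition int_comb (ts : seq (lterm n)) (cs : seq int) : freeLie n :=
  foldr (fun p z => lift_term (@fl_gen n) p.1 *~ p.2 + z) 0 (zip ts cs).

(** Each word turns a linear relation between Lie terms into a linear relation
    between integers, whose coefficients [ds] are found by computation. *)
Lemma int_comb_rel w ds ts cs : [seq word_count w (expand t) | t <- ts] = ds ->
  int_comb ts cs = 0 -> foldr (fun p z => p.1 * p.2 + z) 0 (zip ds cs) = 0.
Proof.
move=> <- E0; suff -> : foldr (fun p z => p.1 * p.2 + z) 0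
    (zip [seq word_count w (expand t) | t <- ts] cs) = wcoef w (embed (int_comb ts cs)).
  by rewrite E0 !raddf0.
rewrite /int_comb; elim: ts cs {E0} => [|t ts IH] [|c cs]; rewrite /= ?raddf0 //.
by rewrite IH (raddfD (@embed n)) (raddfD (wcoef w)) !raddfMz /= wcoef_expand mulrzz.
Qed.

Lemma int_combB ts cs ds : size cs = size ts -> size ds = size ts ->
  int_comb ts cs - int_comb ts ds = int_comb ts [seq p.1 - p.2 | p <- zip cs ds].
Proof.
rewrite /int_comb; elim: ts cs ds => [|t ts IH] [|c cs] [|d ds] //=; first by rewrite subr0.
by case=> Hc [Hd]; rewrite -IH // mulrzBr opprD addrACA.
Qed.

Definition int_span ts (u : freeLie n) :=
  exists2 cs, size cs = size ts & u = int_comb ts cs.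

Lemma int_span0 ts : int_span ts 0.
Proof.
exists (nseq (size ts) 0); first by rewrite size_nseq.
by rewrite /int_comb; elim: ts => //= t ts <-; rewrite mulr0z addr0.
Qed.

Lemma int_spanB ts u v : int_span ts u -> int_span ts v -> int_span ts (u - v).
Proof.
move=> [cs Hc ->] [ds Hd ->]; rewrite int_combB //.
by exists [seq p.1 - p.2 | p <- zip cs ds]; rewrite // size_map size_zip Hc Hd minnn.
Qed.

Lemma int_spanN ts u : int_span ts u -> int_span ts (- u).
Proof. by rewrite -[- u]add0r; apply: int_spanB; apply: int_span0. Qed.

Lemma int_spanD ts u v : int_span ts u -> int_span ts v -> int_span ts (u + v).
Proof. by move=> Hu Hv; rewrite -[v]opprK; apply: int_spanB Hu (int_spanN Hv). Qed.

Lemma int_spanMz ts u (c : int) : int_span ts u -> int_span ts (u *~ c).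
Proof.
move=> Hu; have Hn m : int_span ts (u *+ m).
  by elim: m => [|m IH]; rewrite ?mulrS; [apply: int_span0 | apply: int_spanD].
by case: c => m; rewrite ?NegzE ?mulrNz -pmulrn; [|apply: int_spanN]; apply: Hn.
Qed.

Lemma int_span_mem ts t : t \in ts -> int_span ts (lift_term (@fl_gen n) t).
Proof.
elim: ts => // t' ts IH; rewrite inE => /orP[/eqP ->|/IH [cs Hc ->]].
  have [cs Hc E] := int_span0 ts; exists (1 :: cs); rewrite /= ?Hc //.
  by rewrite /int_comb /= -[foldr _ _ _]E addr0.
exists (0 :: cs); rewrite /= ?Hc //.
by rewrite /int_comb /= mulr0z add0r.
Qed.

Lemma int_span_lie ts ts' v u :
  (forall t, t \in ts -> int_span ts' [lie lift_term (@fl_gen n) t, v]) ->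
  int_span ts u -> int_span ts' [lie u, v].
Proof.
move=> H [cs _ ->]; rewrite /int_comb.
elim: ts cs H => [|t ts IH] [|c cs] H /=; rewrite ?lie0l; try exact: int_span0.
rewrite lieDl lieMzl; apply: int_spanD.
  by apply/int_spanMz/H; rewrite mem_head.
by apply: IH => t' Ht; apply: H; rewrite inE Ht orbT.
Qed.

End Words.

(** * Special derivations on two generators *)

Lemma weightS_ind n k (P : freeLie n -> Prop) : (0 < k)%N ->
  P 0 -> (forall u v, P u -> P v -> P (u - v)) ->
  (forall u i, weight k u -> P [lie u, fl_gen i]) -> forall u, weight k.+1 u -> P u.
Proof.
move=> k0 P0 PB PL u; elim=> [{}u [s ->]||v w _ Pv _ Pw]; [|exact: P0|exact: PB].
have [s' [i ->]] := tuple_rcons s.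
rewrite map_rcons lnorm_rcons; last by case: s' => -[|j s'] //= /eqP Hs; rewrite -Hs in k0.
by apply: PL; apply: zspan_gen; exists s'.
Qed.

Lemma weight1_ind n (P : freeLie n -> Prop) :
  P 0 -> (forall u v, P u -> P v -> P (u - v)) ->
  (forall i, P (fl_gen i)) -> forall u, weight 1 u -> P u.
Proof.
move=> P0 PB PG u; elim=> [{}u [s ->]||v w _ Pv _ Pw]; [|exact: P0|exact: PB].
by case/tupleP: s => i s; rewrite (tuple0 s); apply: PG.
Qed.

Lemma der_ext_inner n (f : der n) t a :
  (forall i, f i = [lie fl_gen i, t]) -> der_ext f a = [lie a, t].
Proof.
move=> Hf; elim/freeLie_ind: a => [i||a Ha|a b Ha Hb|a b Ha Hb].
- by rewrite der_ext_gen.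
- by rewrite raddf0 lie0l.
- by rewrite raddfN /= Ha lieNl.
- by rewrite raddfD /= Ha Hb lieDl.
by rewrite der_ext_br Ha Hb (lieA a) addrC subrK.
Qed.

(** The bracket with [g] of the inner derivation by [t] is the inner derivation
    by [g t]. *)
Lemma br_inner n (f g : der n) t :
  (forall i, f i = [lie fl_gen i, t]) -> der_ext g t = 0 -> [lie f, g] = 0.
Proof.
move=> Hf Hg; apply/ffunP=> i; rewrite !ffunE (der_ext_inner _ Hf) Hf.
by rewrite der_ext_br der_ext_gen Hg lie0r addr0 subrr.
Qed.

Section TwoGenerators.
Implicit Types (u v : freeLie 2).

Lemma ord2_ind (P : 'I_2 -> Prop) : P ord0 -> P ord_max -> forall i, P i.
Proof.
move=> P0 P1 [[|[|//]] lt].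
  by rewrite (_ : Ordinal lt = ord0) //; apply: val_inj.
by rewrite (_ : Ordinal lt = ord_max) //; apply: val_inj.
Qed.

Lemma sum_ord2 (V : nmodType) (F : 'I_2 -> V) : \sum_i F i = F ord0 + F ord_max.
Proof. by rewrite big_ord_recr big_ord1 /=; congr (F _ + _); apply: val_inj. Qed.

Let X := LGen (ord0 : 'I_2).
Let Y := LGen (ord_max : 'I_2).
Let A := LBr X Y.
Let AX := LBr A X.
Let AY := LBr A Y.
Let AXX := LBr AX X.
Let AXY := LBr AX Y.
Let AYY := LBr AY Y.
Local Notation x := (fl_gen (ord0 : 'I_2)).
Local Notation y := (fl_gen (ord_max : 'I_2)).

Lemma weight1_span u : weight 1 u -> int_span [:: X; Y] u.
Proof.
apply: weight1_ind; [exact: int_span0 | exact: int_spanB | apply: ord2_ind].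
  by apply: (@int_span_mem _ _ X); rewrite !inE eqxx.
by apply: (@int_span_mem _ _ Y); rewrite !inE eqxx orbT.
Qed.

Lemma weight2_span u : weight 2 u -> int_span [:: A] u.
Proof.
apply: weightS_ind => // [||{}u i /weight1_span].
- exact: int_span0.
- exact: int_spanB.
have HA : int_span [:: A] [lie x, y] by apply: (@int_span_mem _ _ A); rewrite !inE.
apply: int_span_lie => t; rewrite !inE; elim/ord2_ind: i => /orP[]/eqP -> /=.
- rewrite liexx; exact: int_span0.
- rewrite lieC; exact: int_spanN.
- done.
- rewrite liexx; exact: int_span0.
Qed.

Lemma weight3_span u : weight 3 u -> int_span [:: AX; AY] u.
Proof.
apply: weightS_ind => // [||{}u i /weight2_span].
- exact: int_span0.
- exact: int_spanB.
apply: int_span_lie => t; rewrite !inE; elim/ord2_ind: i => /eqP ->.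
  by apply: (@int_span_mem _ _ AX); rewrite !inE eqxx.
by apply: (@int_span_mem _ _ AY); rewrite !inE eqxx orbT.
Qed.

Lemma weight4_span u : weight 4 u -> int_span [:: AXX; AXY; AYY] u.
Proof.
have HXY : [lie [lie [lie x, y], y], x] = [lie [lie [lie x, y], x], y].
  by apply/esym/eqP; rewrite -subr_eq0 -lieA liexx.
apply: weightS_ind => // [||{}u i /weight3_span].
- exact: int_span0.
- exact: int_spanB.
apply: int_span_lie => t; rewrite !inE; elim/ord2_ind: i => /orP[]/eqP ->.
- by apply: (@int_span_mem _ _ AXX); rewrite !inE eqxx.
- by rewrite /= HXY; apply: (@int_span_mem _ _ AXY); rewrite !inE eqxx orbT.
- by apply: (@int_span_mem _ _ AXY); rewrite !inE eqxx orbT.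
- by apply: (@int_span_mem _ _ AYY); rewrite !inE eqxx !orbT.
Qed.

Lemma bn2_special k (f : der 2) : (0 < k)%N -> bn_deg k f ->
  exists u v, [/\ weight k u, weight k v, f ord0 = [lie u, x], f ord_max = [lie v, y]
    & [lie u, x] + [lie v, y] = 0].
Proof.
move=> k0 [/(pnP _ k0) [u Hu]]; rewrite sum_ord2.
have [H0 ->] := Hu ord0; have [H1 ->] := Hu ord_max.
by exists (u ord0), (u ord_max).
Qed.

(** Write [f x_i = [\sum_j m_ij x_j, x_i]].  The diagonal entries of [m] do not
    contribute, and the coefficient of [[x, y]] in the sum of the values of [f]
    says that [m] is symmetric. *)
Lemma bn2_deg1 (f : der 2) : bn_deg 1 f ->
  exists c : int, forall i, f i = [lie fl_gen i, (x + y) *~ c].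
Proof.
case/bn2_special=> // u [v [/weight1_span + /weight1_span + f0 f1]].
case=> [[|c0 [|c1 []]] //= _ Eu] [[|d0 [|d1 []]] //= _ Ev] E.
have := @int_comb_rel _ [:: ord0; ord_max] [:: -1; 1] [:: LBr Y X; LBr X Y] [:: c1; d0].
have -> : int_comb [:: LBr Y X; LBr X Y] [:: c1; d0] = 0.
  rewrite -E Eu Ev /int_comb /= !addr0 !lieDl !lieMzl !liexx !mul0rz addr0 add0r //.
rewrite /= => /(_ erefl erefl) Ec.
have {}Ec : d0 = c1 by lia.
exists (- c1); elim/ord2_ind.
  rewrite f0 Eu /int_comb /= addr0 lieDl !lieMzl lieMzr liexx mul0rz add0r.
  by rewrite lieDr liexx add0r lieC mulNrz -mulrNz.
rewrite f1 Ev Ec /int_comb /= addr0 lieDl !lieMzl lieMzr liexx mul0rz addr0.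
by rewrite lieDr liexx addr0 lieC mulNrz -mulrNz.
Qed.

(** Bracketing with [x] and [y] sends the single element [[x, y]] of weight 2 to
    two independent elements of weight 3. *)
Lemma bn2_deg2 (f : der 2) : bn_deg 2 f -> f = 0.
Proof.
case/bn2_special=> // u [v [/weight2_span + /weight2_span + f0 f1]].
case=> [[|c []] //= _ Eu] [[|d []] //= _ Ev] E.
pose ts := [:: LBr A X; LBr A Y].
have R w ds : [seq word_count w (expand t) | t <- ts] = ds ->
    foldr (fun p z => p.1 * p.2 + z) 0 (zip ds [:: c; d]) = 0.
  move/int_comb_rel; apply; rewrite -E Eu Ev /int_comb /= !addr0 !lieMzl //.
have Rc := R [:: ord_max; ord0; ord0] [:: -1; 0] erefl.
have Rd := R [:: ord0; ord_max; ord_max] [:: 0; 1] erefl.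
have c0 : c = 0 by move: Rc Rd; rewrite /=; lia.
have d0 : d = 0 by move: Rc Rd; rewrite /=; lia.
apply/ffunP; elim/ord2_ind; rewrite ffunE ?f0 ?f1 ?Eu ?Ev /int_comb /= ?c0 ?d0.
  by rewrite mulr0z addr0 lie0l.
by rewrite mulr0z addr0 lie0l.
Qed.

(** The weights 4 and 5 have ranks 3 and 6, and the six brackets of a basis
    element of weight 4 with [x] or [y] are independent. *)
Lemma bn2_deg4 (f : der 2) : bn_deg 4 f -> f = 0.
Proof.
case/bn2_special=> // u [v [/weight4_span + /weight4_span + f0 f1]].
case=> [[|c0 [|c1 [|c2 []]]] //= _ Eu] [[|d0 [|d1 [|d2 []]]] //= _ Ev] E.
pose ts := [:: LBr AXX X; LBr AXY X; LBr AYY X; LBr AXX Y; LBr AXY Y; LBr AYY Y].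
have R w ds : [seq word_count w (expand t) | t <- ts] = ds ->
    foldr (fun p z => p.1 * p.2 + z) 0 (zip ds [:: c0; c1; c2; d0; d1; d2]) = 0.
  move/int_comb_rel; apply; rewrite -E Eu Ev /int_comb /= !addr0 !lieDl !lieMzl.
  by rewrite !addrA.
(* Words each occurring in only one of the six brackets. *)
have Rc0 := R [:: ord_max; ord0; ord0; ord0; ord0] [:: -1; 0; 0; 0; 0; 0] erefl.
have Rc1 := R [:: ord0; ord0; ord_max; ord_max; ord0] [:: 0; -1; 0; 0; 0; 0] erefl.
have Rc2 := R [:: ord0; ord_max; ord_max; ord0; ord_max] [:: 0; 0; -3; 0; 0; 0] erefl.
have Rd0 := R [:: ord0; ord_max; ord0; ord0; ord_max] [:: 0; 0; 0; 3; 0; 0] erefl.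
have Rd1 := R [:: ord_max; ord0; ord0; ord_max; ord_max] [:: 0; 0; 0; 0; 1; 0] erefl.
have Rd2 := R [:: ord0; ord_max; ord_max; ord_max; ord_max] [:: 0; 0; 0; 0; 0; 1] erefl.
have [[e0 [e1 e2]] [e3 [e4 e5]]] :
    (c0 = 0 /\ c1 = 0 /\ c2 = 0) /\ (d0 = 0 /\ d1 = 0 /\ d2 = 0).
  by move: Rc0 Rc1 Rc2 Rd0 Rd1 Rd2; rewrite /=; lia.
apply/ffunP; elim/ord2_ind; rewrite ffunE ?f0 ?f1 ?Eu ?Ev /int_comb /=.
  by rewrite e0 e1 e2 !mulr0z !addr0 lie0l.
by rewrite e3 e4 e5 !mulr0z !addr0 lie0l.
Qed.

(** One of two positive integers of sum 7 is 1, 2 or 4. *)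
Lemma bn2_br_deg7 k l (f g : der 2) : (0 < k)%N -> (0 < l)%N -> (k + l = 7)%N ->
  bn_deg k f -> bn_deg l g -> [lie f, g] = 0.
Proof.
have H1 m (h h' : der 2) : bn_deg 1 h -> bn_deg m h' -> [lie h, h'] = 0.
  case/bn2_deg1=> c Hh [_]; rewrite sum_ord2 => Hh'.
  by apply: (br_inner Hh); rewrite raddfMz raddfD /= !der_ext_gen Hh' mul0rz.
move=> k0 l0 kl Hf Hg.
have low : k \in [:: 1; 2; 4]%N \/ l \in [:: 1; 2; 4]%N.
  by move: k0 l0 kl; rewrite !inE; lia.
have H m (h : der 2) m' (h' : der 2) : m \in [:: 1; 2; 4]%N ->
    bn_deg m h -> bn_deg m' h' -> [lie h, h'] = 0.
  rewrite !inE => /or3P[]/eqP -> Hh Hh'.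
  - exact: H1 Hh Hh'.
  - by rewrite (bn2_deg2 Hh) lie0l.
  - by rewrite (bn2_deg4 Hh) lie0l.
case: low => Hm; first exact: H Hm Hf Hg.
by rewrite lieC (H _ _ _ _ Hm Hg Hf) oppr0.
Qed.

End TwoGenerators.

(** * Restriction to fewer generators *)

Section Restriction.
Variables (m n : nat) (le_mn : (m <= n)%N).
Implicit Types (a b : freeLie n) (f g : der n).

Definition kill_gen (i : 'I_n) : freeLie m := oapp (@fl_gen m) 0 (insub (val i)).
Definition restr a : freeLie m := fl_lift kill_gen a.

Fact restr_is_zmod_morphism : zmod_morphism restr.
Proof. exact: raddfB. Qed.
HB.instance Definition _ :=
  GRing.isZmodMorphism.Build (freeLie n) (freeLie m) restr restr_is_zmod_morphism.

Definition der_restr f : der m := [ffun j => restr (f (widen_ord le_mn j))].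

Lemma restr_br a b : restr [lie a, b] = [lie restr a, restr b].
Proof. exact: fl_lift_br. Qed.

Lemma restr_widen j : restr (fl_gen (widen_ord le_mn j)) = fl_gen j.
Proof. by rewrite /restr fl_lift_gen /kill_gen /= valK. Qed.

Lemma restr_gen i : (exists2 j, i = widen_ord le_mn j & restr (fl_gen i) = fl_gen j)
  \/ restr (fl_gen i) = 0.
Proof.
have [lt|ge] := ltnP i m.
  have -> : i = widen_ord le_mn (Ordinal lt) by apply: val_inj.
  by left; exists (Ordinal lt) => //; apply: restr_widen.
by right; rewrite /restr fl_lift_gen /kill_gen insubF // ltnNge ge.
Qed.

Lemma pn_restr0 k f i : (0 < k)%N -> pn k f -> restr (fl_gen i) = 0 -> restr (f i) = 0.
Proof. by move=> k0 /(pnP _ k0) [u /(_ i) [_ ->]] Hi; rewrite restr_br Hi lie0r. Qed.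

(** Special derivations preserve the kernel of [restr], since they send [x_i] to
    a bracket with [x_i]. *)
Lemma restr_der k f a : (0 < k)%N -> pn k f ->
  restr (der_ext f a) = der_ext (der_restr f) (restr a).
Proof.
move=> k0 Hf; elim/freeLie_ind: a => [i||a Ha|a b Ha Hb|a b Ha Hb].
- rewrite der_ext_gen; have [[j -> ->]|Hi] := restr_gen i.
    by rewrite der_ext_gen ffunE.
  by rewrite Hi raddf0 (pn_restr0 k0 Hf).
- by rewrite !raddf0.
- by rewrite !raddfN /= Ha.
- by rewrite !raddfD /= Ha Hb.
by rewrite der_ext_br (raddfD restr) /= !restr_br der_ext_br Ha Hb.
Qed.

Lemma der_restr_br k l f g : (0 < k)%N -> (0 < l)%N -> pn k f -> pn l g ->
  der_restr [lie f, g] = [lie der_restr f, der_restr g].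
Proof.
move=> k0 l0 Hf Hg; apply/ffunP=> j; rewrite !ffunE raddfB /=.
by rewrite (restr_der _ k0 Hf) (restr_der _ l0 Hg).
Qed.

Lemma restr_weight k a : (0 < k)%N -> weight k a -> weight k (restr a).
Proof.
have W0 i : weight 1 (restr (fl_gen i)).
  by have [[j _ ->]|->] := restr_gen i; [apply: weight_gen | apply: zspan0].
case: k => // k _; elim: k a => [|k IH].
  apply: weight1_ind => [|u v Hu Hv|//]; first by rewrite raddf0; apply: zspan0.
  by rewrite raddfB; apply: zspanB.
apply: weightS_ind => // [|u v Hu Hv|u i Hu]; first by rewrite raddf0; apply: zspan0.
  by rewrite raddfB; apply: zspanB.
rewrite restr_br -[k.+2]addn1; apply: weight_br => //; exact: IH.
Qed.

Lemma der_restr_bn k f : (0 < k)%N -> bn_deg k f -> bn_deg k (der_restr f).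
Proof.
move=> k0 [pf sf]; have /(pnP _ k0) [u Hu] := pf; split.
  apply/(pnP _ k0); exists (fun j => restr (u (widen_ord le_mn j))) => j.
  have [wu fu] := Hu (widen_ord le_mn j); split; first exact: restr_weight.
  by rewrite ffunE fu restr_br restr_widen.
transitivity (\sum_(i < n | (i < m)%N) restr (f i)).
  by rewrite (big_ord_narrow le_mn); apply: eq_bigr => j _; rewrite ffunE.
rewrite big_mkcond.
transitivity (restr (\sum_i f i)); last by rewrite sf raddf0.
rewrite raddf_sum; apply: eq_bigr => i _; case: ifP => // /negbT; rewrite -leqNgt => mi.
by rewrite /= (pn_restr0 k0 pf) // /restr fl_lift_gen /kill_gen insubF // ltnNge mi.
Qed.

Fact der_restr_is_zmod_morphism : zmod_morphism der_restr.
Proof. by move=> f g; apply/ffunP=> j; rewrite !ffunE raddfB. Qed.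
HB.instance Definition _ :=
  GRing.isZmodMorphism.Build (der n) (der m) der_restr der_restr_is_zmod_morphism.

End Restriction.

(** * A special derivation of degree 7 *)

Section Tripod.
Variables (L : lieType) (x y : L).
Local Notation a := [lie x, y].
Local Notation b := [lie a, x].
Local Notation c := [lie a, y].

(** The sums, over the leaves labelled [x] or [y], of the tree with branches [a],
    [b], [c] rooted at that leaf. *)
Definition tripod_x : L :=
  [lie y, [lie b, c]] + [lie y, [lie x, [lie c, a]]] + [lie [lie c, a], a]
  + [lie y, [lie y, [lie a, b]]].
Definition tripod_y : L :=
  [lie [lie b, c], x] + [lie [lie x, [lie c, a]], x] + [lie [lie y, [lie a, b]], x]
  + [lie [lie a, b], a].

(** A tree [t] grafted at the root of [[u, v]] is [[v, t]] as seen from [u] and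
    [[t, u]] as seen from [v]; this is the Jacobi identity. *)
Lemma lie_leaf t u v : [lie u, [lie v, t]] + [lie v, [lie t, u]] = [lie [lie u, v], t] :> L.
Proof. by have/eqP := lie_jacobi u v t; rewrite (lieC t [lie u, v]) subr_eq0 => /eqP. Qed.

Lemma tripod_sum : [lie tripod_x, x] + [lie tripod_y, y] = 0.
Proof.
rewrite (lieC _ x) (lieC _ y) -opprD; apply/eqP; rewrite oppr_eq0; apply/eqP.
rewrite /tripod_x /tripod_y !lieDr.
(* One group for each branch [a], [b], [c]; in [b] and [c] the two leaves of
   the subtree [a] are merged first. *)
rewrite (AC (4*4) ((1*5)*((2*6)*3)*((4*7)*8))) /=.
by rewrite !(lie_leaf _ x y) (lie_leaf _ a x) (lie_leaf _ a y) lie_jacobi.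
Qed.
End Tripod.

Section FoxTripod.
Variables (L : lieType) (R : comNzRingType) (lin D : {additive L -> R}).
Hypothesis lin_br : forall a b, lin [lie a, b] = 0.
Hypothesis D_br : forall a b, D [lie a, b] = D a * lin b - D b * lin a.
Local Notation simp0 := (mulr0, mul0r, subrr, addr0, add0r, sub0r, oppr0).

(** Every term of [tripod_x] contains a bracket of two brackets, and such a bracket
    generates an ideal killed by [D] and [lin]. *)
Lemma fox_tripod_x (x y z : L) : D [lie tripod_x x y, z] = 0.
Proof.
rewrite D_br (_ : lin (tripod_x x y) = 0); last by rewrite /tripod_x !raddfD /= !lin_br !addr0.
by rewrite mulr0 subr0 /tripod_x !raddfD /= !D_br !lin_br !simp0.
Qed.

Lemma fox_tripod_y (x y z : L) : D [lie tripod_y x y, z] = 0.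
Proof.
rewrite D_br (_ : lin (tripod_y x y) = 0); last by rewrite /tripod_y !raddfD /= !lin_br !addr0.
by rewrite mulr0 subr0 /tripod_y !raddfD /= !D_br !lin_br !simp0.
Qed.
End FoxTripod.

Section Element.
Variables (n : nat) (hn : (2 <= n)%N).
Let i0 : 'I_n := widen_ord hn ord0.
Let i1 : 'I_n := widen_ord hn ord_max.
Local Notation x := (fl_gen i0).
Local Notation y := (fl_gen i1).

Definition tripod_leaf (i : 'I_n) : freeLie n :=
  if i == i0 then tripod_x x y else if i == i1 then tripod_y x y else 0.
Definition tripod : der n := [ffun i => [lie tripod_leaf i, fl_gen i]].

Lemma weight_tripod_leaf i : weight 7 (tripod_leaf i).
Proof.
have wx := weight_gen i0; have wy := weight_gen i1.
have wa := weight_br (k := 1) (l := 1) isT isT wx wy.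
have wb := weight_br (k := 2) (l := 1) isT isT wa wx.
have wc := weight_br (k := 2) (l := 1) isT isT wa wy.
have wbc := weight_br (k := 3) (l := 3) isT isT wb wc.
have wca := weight_br (k := 3) (l := 2) isT isT wc wa.
have wab := weight_br (k := 2) (l := 3) isT isT wa wb.
rewrite /tripod_leaf; case: eqP => _; [|case: eqP => _; last exact: zspan0].
  do 3?apply: zspanD.
  - exact: (weight_br (k := 1) (l := 6)).
  - exact/(weight_br (k := 1) (l := 6))/(weight_br (k := 1) (l := 5)).
  - exact: (weight_br (k := 5) (l := 2)).
  - exact/(weight_br (k := 1) (l := 6))/(weight_br (k := 1) (l := 5)).
do 3?apply: zspanD.
- exact: (weight_br (k := 6) (l := 1)).
- by apply: (weight_br (k := 6) (l := 1)) => //; apply: (weight_br (k := 1) (l := 5)).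
- by apply: (weight_br (k := 6) (l := 1)) => //; apply: (weight_br (k := 1) (l := 5)).
- exact: (weight_br (k := 5) (l := 2)).
Qed.

Lemma tripod_bn : bn_deg 7 tripod.
Proof.
split.
  apply/pnP=> //; exists tripod_leaf => i; split; first exact: weight_tripod_leaf.
  by rewrite ffunE.
have ne : i1 != i0 by [].
rewrite (bigD1 i0) // (bigD1 i1) //= big1 => [|i /andP[/negPf e0 /negPf e1]].
  by rewrite addr0 !ffunE /tripod_leaf eqxx (negPf ne) eqxx tripod_sum.
by rewrite ffunE /tripod_leaf e0 e1 lie0l.
Qed.

Lemma MT_tripod : MT tripod = 0.
Proof.
rewrite /MT big1 // => i _; rewrite ffunE /tripod_leaf.
case: eqP => _; first exact: (fox_tripod_x (@linpart_br n) (lfox_br i)).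
case: eqP => _; first exact: (fox_tripod_y (@linpart_br n) (lfox_br i)).
by rewrite lie0l !raddf0.
Qed.

Lemma tripod_x_neq0 :
  [lie tripod_x (fl_gen (ord0 : 'I_2)) (fl_gen ord_max), fl_gen ord0] <> 0.
Proof.
pose X := LGen (ord0 : 'I_2); pose Y := LGen (ord_max : 'I_2).
pose A := LBr X Y; pose B := LBr A X; pose C := LBr A Y.
pose T := LBr (LAdd (LAdd (LAdd (LBr Y (LBr B C)) (LBr Y (LBr X (LBr C A))))
  (LBr (LBr C A) A)) (LBr Y (LBr Y (LBr A B)))) X.
rewrite -[[lie _, _]]/(lift_term (@fl_gen 2) T) => E.
pose w := [:: ord0; ord0; ord0; ord_max; ord0; ord_max; ord_max; ord_max : 'I_2].
by have := wcoef_expand w T; rewrite E !raddf0; vm_compute.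
Qed.

Lemma restr_tripod_neq0 : der_restr hn tripod <> 0.
Proof.
move/ffunP=> /(_ ord0); rewrite !ffunE restr_br /tripod_leaf eqxx.
rewrite /tripod_x !raddfD /= !restr_br !restr_widen; exact: tripod_x_neq0.
Qed.
End Element.

(** * Maps out of the abelianization *)

Section H1Lift.
Variables (L : lieType) (V : zmodType) (f : {additive L -> V}).
Hypothesis f_br : forall a b, f [lie a, b] = 0.

Lemma derived0 a : a \in @derived L -> f a = 0.
Proof.
move/asboolP; elim=> [b [c [d ->]]||b c _ Hb _ Hc]; first exact: f_br.
  exact: raddf0.
by rewrite raddfB /= Hb Hc subrr.
Qed.

Lemma H1_pi_eq a b : H1_pi a = H1_pi b -> f a = f b.
Proof.
move=> E; apply/eqP; rewrite -subr_eq0 -raddfB; apply/eqP/derived0.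
by rewrite Quotient.idealrBE; apply/eqP.
Qed.

Lemma H1_lift_exists : exists h : {additive H1 L -> V}, forall a, h (H1_pi a) = f a.
Proof.
pose h (u : H1 L) := f (repr u).
have hE a : h (H1_pi a) = f a by apply: H1_pi_eq; apply: reprK.
have hB : zmod_morphism h.
  move=> u v; rewrite -[u]reprK -[v]reprK -/(H1_pi _) -/(H1_pi _).
  by rewrite -[X in h X](raddfB (@H1_pi L)) !hE raddfB.
pose hA := GRing.isZmodMorphism.Build (H1 L) V h hB.
pose H : {additive H1 L -> V} := HB.pack h hA.
by exists H.
Qed.
End H1Lift.

Section GradedBracket.
Variables (L : lieType) (V : zmodType) (phi : {additive L -> V}).

Lemma graded_br_coef (F G : graded L) d :
  (forall k l, (k + l = d)%N -> phi [lie F@_k, G@_l] = 0) -> phi ([lie F, G]@_d) = 0.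
Proof.
move=> H; have -> : [lie F, G] = gr_br F G by [].
rewrite /gr_br (raddf_sum (mcoeff d)) raddf_sum big1 // => k _.
rewrite (raddf_sum (mcoeff d)) raddf_sum big1 // => l _ /=.
by rewrite mcoeffU; case: eqP => [/H //|_]; rewrite mulr0n raddf0.
Qed.
End GradedBracket.

Section Theta.
Variable n : nat.

Lemma bn_comp (F : bn n) k : (0 < k)%N -> bn_deg k (\val F)@_k.
Proof. by move=> k0; have /asboolP[_] := valP F; apply. Qed.

Lemma bn_comp0 (F : bn n) : (\val F)@_0 = 0.
Proof. by have /asboolP[] := valP F. Qed.

Lemma bn_br_coef (V : zmodType) (phi : {additive der n -> V}) (F G : bn n) d :
  (forall k l f g, (0 < k)%N -> (0 < l)%N -> (k + l = d)%N ->
     bn_deg k f -> bn_deg l g -> phi [lie f, g] = 0) ->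
  phi ((\val [lie F, G])@_d) = 0.
Proof.
move=> H; apply: (graded_br_coef (F := \val F) (G := \val G)) => -[|k] [|l] kl.
- by rewrite bn_comp0 lie0l raddf0.
- by rewrite bn_comp0 lie0l raddf0.
- by rewrite (bn_comp0 G) lie0r raddf0.
- by apply: H kl _ _ => //; apply: bn_comp.
Qed.

Lemma Theta_target_eq0 (P : Theta_target n) :
  \val P.1 = 0 -> (forall m, (0 < m)%N -> (\val P.2)@_m = 0) -> P = 0.
Proof.
case: P => p q /= p0 q0; congr pair; apply: val_inj => //=.
apply/malgP=> -[|m]; last by rewrite q0 // mcoeff0.
by rewrite mcoeff0; have /asboolP[] := valP q.
Qed.

Lemma Theta_br (F G : bn n) : Theta [lie F, G] = 0.
Proof.
apply: Theta_target_eq0 => [|m m0].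
  rewrite Theta_fstE; apply: (bn_br_coef (phi := idfun)) => k l f g k0 l0 kl.
  lia.
rewrite Theta_sndE //; apply: (bn_br_coef (phi := @MT n)).
move=> -[|k] [|l] f g // _ _ _ [Hf _] [Hg _].
exact: MT_br Hf Hg.
Qed.

Lemma Theta_surj (P : Theta_target n) : exists F : bn n, Theta F = P.
Proof.
case: P => p q.
have /choice[h Hh] : forall m, exists f : der n,
    (0 < m)%N -> bn_deg m.*2.+1 f /\ MT f = (\val q)@_m.
  move=> [|m]; first by exists 0.
  by have /asboolP[_ /(_ m.+1 isT) [f Hf Ef]] := valP q; exists f.
pose D := [fset m.*2.+1 | m in msupp (\val q)]%fset.
pose F : graded (der n) :=
  [malg k in 1%N |` D => if k == 1%N then \val p else h k./2]%fset.
have FE k : F@_k =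
    if k \in (1%N |` D)%fset then (if k == 1%N then \val p else h k./2) else 0.
  exact: mcoeffE.
have F1 : F@_1 = \val p by rewrite FE !inE.
have inD m : (m.*2.+1 \in D) = (m \in msupp (\val q)).
  apply/imfsetP/idP => [[m' /= Hm' [/double_inj ->]] //|Hm]; by exists m.
have q0 : (\val q)@_0 = 0 by have /asboolP[] := valP q.
have Fodd m : (0 < m)%N -> F@_m.*2.+1 = if m \in msupp (\val q) then h m else 0.
  by case: m => // m _; rewrite FE !inE inD /= uphalf_double.
have FP : F \in bn_pred (n:=n).
  apply/asboolP; split=> [|k k0].
    rewrite FE !inE /=; case: imfsetP => // -[m _ //].
  have [->|k1] := eqVneq k 1%N; first by rewrite F1; have /asboolP := valP p.
  rewrite FE !inE (negPf k1) /=; case: ifP => [/imfsetP[m /= Hm ->]|_]; last exact: bn_deg0.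
  rewrite /= uphalf_double; have [m0|m0] := posnP m; last by have [] := Hh m m0.
  by move: Hm; rewrite m0 -mcoeff_neq0 q0 eqxx.
exists (exist (fun F => F \in bn_pred (n:=n)) F FP).
congr pair; apply: val_inj => //.
apply/malgP=> -[|m]; first by rewrite q0; have /asboolP[] := valP (Theta (exist _ F FP)).2.
rewrite (Theta_sndE (exist _ F FP)) // Fodd //; case: ifP => [_|/negbT Hm].
  by have [] := Hh m.+1 isT.
by rewrite raddf0 mcoeff_outdom.
Qed.

Definition restr7 (hn : (2 <= n)%N) (F : bn n) : der 2 := der_restr hn (\val F)@_7.

Fact restr7_is_zmod_morphism hn : zmod_morphism (restr7 hn).
Proof.
move=> F G; rewrite /restr7.
by rewrite (_ : (\val (F - G))@_7 = (\val F)@_7 - (\val G)@_7) ?raddfB //; apply: mcoeffB.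
Qed.
HB.instance Definition _ hn :=
  GRing.isZmodMorphism.Build (bn n) (der 2) (restr7 hn) (restr7_is_zmod_morphism hn).

Lemma restr7_br hn (F G : bn n) : restr7 hn [lie F, G] = 0.
Proof.
apply: (bn_br_coef (phi := der_restr hn)) => k l f g k0 l0 kl Hf Hg.
apply: etrans (der_restr_br hn k0 l0 Hf.1 Hg.1) _.
by apply: (bn2_br_deg7 k0 l0 kl); apply: der_restr_bn.
Qed.

End Theta.

Theorem theorem2 (n : nat) (hn : (3 <= n)%N) :
  exists Theta_bar : {additive H1 (bn n) -> Theta_target n},
    [/\ lie_morphism Theta_bar,
        forall F : bn n, Theta_bar (H1_pi F) = Theta F,
        forall y : Theta_target n, exists x : H1 (bn n), Theta_bar x = y
      & ~ injective Theta_bar].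
Proof.
have [h hE'] := H1_lift_exists (@Theta_br n).
have hE (F : bn n) : h (H1_pi F) = Theta F by exact: hE'.
exists h; split=> [u v|//|P|h_inj].
- have -> : [lie u, v] = H1_pi [lie repr u, repr v] by [].
  by rewrite H1_pi_br raddf0.
- by have [F <-] := Theta_surj P; exists (H1_pi F).
have h2 : (2 <= n)%N by apply: ltnW.
pose T : graded (der n) := << tripod h2 *g 7%N >>.
have TP : T \in bn_pred (n:=n).
  apply/asboolP; rewrite /T; split=> [|k k0]; rewrite mcoeffU //.
  case: eqP => [<-|_]; [exact: tripod_bn | exact: bn_deg0].
pose F : bn n := exist _ T TP.
have F0 : Theta F = 0.
  apply: Theta_target_eq0 => [|m m0].
    by rewrite Theta_fstE /= mcoeffU.
  rewrite Theta_sndE //= /T mcoeffU; case: eqP => _; [exact: MT_tripod | exact: raddf0].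
have : H1_pi F = H1_pi 0 by apply: h_inj; rewrite !hE F0 raddf0.
move/(H1_pi_eq (f := restr7 h2) (restr7_br h2)).
rewrite raddf0 => E; apply: (@restr_tripod_neq0 _ h2); rewrite -{}E /restr7.
by congr der_restr; symmetry; apply: mcoeffUU.
Qed.
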